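(* Let $h_1,h_2,\ldots,h_n$ be rotation quaternions such that $h_i$ and $h_{i+1}$ are not compatible for $i=1,\ldots,n-1$. Then the following hold (parts b)–d) concern the first two, respectively three, quaternions whenever these exist): a) All coupling dimensions $l_{1,\ldots,i}$ with $1\le i\le n$ are even. b) $l_{1,2}=4$. Moreover, (the projectivization of) $L_{1,2}$ is contained in the Study quadric $S$ if and only if the axes of $h_1$ and $h_2$ are concurrent. c) If $\dim L_{1,2,3}=4$, then the axes of $h_1,h_2,h_3$ are concurrent. d) If $\dim L_{1,2,3}=6$, then the axes of $h_1,h_2,h_3$ satisfy the Bennett conditions: the normal feet of the axes of $h_1$ and $h_3$ on the axis of $h_2$ coincide, and the normal distances $d_{i,i+1}$ and angles $\alpha_{i,i+1}$ between consecutive axes satisfy $d_{12}/\sin\alpha_{12}=d_{23}/\sin\alpha_{23}$.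
   Context: Let $\mathbb{D}=\mathbb{R}+\epsilon\mathbb{R}$ with $\epsilon^2=0$ be the dual numbers and $\mathbb{DH}$ the quaternions with coefficients in $\mathbb{D}$ (a real algebra of dimension 8). Every dual quaternion is $h=p+\epsilon q$ with quaternions $p$ (primal part) and $q$ (dual part); it also has a scalar part in $\mathbb{D}$ and a vectorial part in $\mathbb{D}^3$. The conjugate $\overline h$ is obtained by multiplying the vectorial part by $-1$; the norm is $h\overline h\in\mathbb{D}$ and the trace is $h+\overline h\in\mathbb{D}$. The Study quadric $S\subset\mathbb{P}^7=\mathbb{P}(\mathbb{DH})$ is the set of classes of $h$ such that $h\overline h$ has zero dual part. A nonzero dual quaternion is a rotation quaternion (represents a rotation of $\mathbb{R}^3$) if its norm and trace are strictly real (dual part zero) and its primal vectorial part is nonzero; $h=p+\epsilon q$ acts on $\mathbb{R}^3$ by $v\mapsto (pv\overline p+p\overline q-q\overline p)/(p\overline p)$, and its axis is the rotation axis in $\mathbb{R}^3$. (A revolute joint is represented by a rotation quaternion $h$ with zero scalar part and $h\overline h=-h^2=1$, a half-turn.) Two rotation quaternions with the same axis are called compatible. Two or more lines are called concurrent if they are all parallel or all intersect in a common point. The coupling space $L_{i,i+1,\ldots,j}$ is the real linear subspace of $\mathbb{DH}\cong\mathbb{R}^8$ generated by all products $h_{k_1}\cdots h_{k_s}$ with $i\le k_1<\cdots<k_s\le j$, including the empty product $1$. The coupling dimension is $l_{i,\ldots,j}=\dim L_{i,\ldots,j}$. The normal foot of a line $a$ on a line $b$ is the point where the common perpendicular of $a$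 and $b$ meets $b$; the normal distance and angle between two lines are the length of their common perpendicular and the angle between their directions. *)

(* Defs.v *)
From HB Require Import structures.
From mathcomp Require Import all_boot all_order all_algebra.
From mathcomp Require Import boolp classical_sets reals trigo.
From mathcomp Require Import ring.

Set Implicit Arguments.
Unset Strict Implicit.
Unset Printing Implicit Defensive.

Import Order.TTheory GRing.Theory Num.Theory.
Local Open Scope classical_set_scope.
Local Open Scope ring_scope.

Section Euclidean.
Context {R : realType}.
Implicit Types u v : 'rV[R]_3.

Definition dotv u v : R := \sum_(i < 3) u 0 i * v 0 i.

(* Indices are taken modulo 3 ('I_3 is the additive group Z/3). *)
Definition crossv u v : 'rV[R]_3 :=
  \row_(i < 3) (u 0 (i + 1) * v 0 (i + 2%:R) - u 0 (i + 2%:R) * v 0 (i + 1)).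

(* Euclidean norm; the norm `|u| of the library is the sup norm. *)
Definition normv u : R := Num.sqrt (dotv u u).

End Euclidean.

(* The quaternion s + v, with scalar part s and vectorial part v. The underlying
   product type only provides the real vector space structure: its
   componentwise product is not the one used on [quat R]. *)
Definition quat (R : realType) : Type := (R^o * 'rV[R]_3)%type.
HB.instance Definition _ (R : realType) := Vector.on (quat R).

Section Quaternions.
Context {R : realType}.
Implicit Types p q r : quat R.

Definition Quat (s : R) (v : 'rV[R]_3) : quat R := (s, v).
Definition qscal p : R := p.1.
Definition qvec p : 'rV[R]_3 := p.2.

Definition qmul p q : quat R :=
  Quat (qscal p * qscal q - dotv (qvec p) (qvec q))
       (qscal p *: qvec q + qscal q *: qvec p + crossv (qvec p) (qvec q)).
Definition qone : quat R := Quat 1 0.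
Definition qconj p : quat R := Quat (qscal p) (- qvec p).

Lemma quatP p q :
  qscal p = qscal q -> (forall i, qvec p 0 i = qvec q 0 i) -> p = q.
Proof.
case: p q => [a u] [b v]; rewrite /qscal /qvec /= => -> uv.
by congr pair; apply/rowP.
Qed.

Lemma I3P (P : 'I_3 -> Prop) : P 0 -> P 1 -> P 2%:R -> forall i, P i.
Proof.
move=> P0 P1 P2 [[|[|[|//]]] lti].
- by rewrite (_ : Ordinal lti = 0)//; apply/val_inj.
- by rewrite (_ : Ordinal lti = 1)//; apply/val_inj.
- by rewrite (_ : Ordinal lti = 2%:R)//; apply/val_inj.
Qed.

Lemma sumI3 (F : 'I_3 -> R) : \sum_i F i = F 0 + F 1 + F 2%:R.
Proof.
rewrite !big_ord_recl big_ord0 addr0 addrA.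
by congr (F _ + F _ + F _); apply/val_inj.
Qed.

Let i01 : 0 + 1 = 1 :> 'I_3. Proof. exact/val_inj. Qed.
Let i02 : 0 + 2%:R = 2%:R :> 'I_3. Proof. exact/val_inj. Qed.
Let i11 : 1 + 1 = 2%:R :> 'I_3. Proof. exact/val_inj. Qed.
Let i12 : 1 + 2%:R = 0 :> 'I_3. Proof. exact/val_inj. Qed.
Let i21 : 2%:R + 1 = 0 :> 'I_3. Proof. exact/val_inj. Qed.
Let i22 : 2%:R + 2%:R = 1 :> 'I_3. Proof. exact/val_inj. Qed.
Let I3E := (i01, i02, i12, i21, i22, i11).

Let qscalD p q : qscal (p + q) = qscal p + qscal q. Proof. by []. Qed.
Let qvecD p q : qvec (p + q) = qvec p + qvec q. Proof. by []. Qed.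
Let qscalZ (a : R) p : qscal (a *: p) = a * qscal p. Proof. by []. Qed.
Let qvecZ (a : R) p : qvec (a *: p) = a *: qvec p. Proof. by []. Qed.
Let qscalQ s v : qscal (Quat s v) = s. Proof. by []. Qed.
Let qvecQ s v : qvec (Quat s v) = v. Proof. by []. Qed.

Ltac quat_ring :=
  apply: quatP => [|]; last (apply: I3P);
  rewrite /qmul /qone /dotv /crossv
    !(qscalQ, qvecQ, qscalD, qvecD, qscalZ, qvecZ) ?sumI3 ?mxE ?I3E ?mxE ?I3E;
  ring.

Lemma qmulA : associative qmul.
Proof. by move=> p q r; quat_ring. Qed.
Lemma qmul1 : left_id qone qmul.
Proof. by move=> p; quat_ring. Qed.
Lemma qmulr1 : right_id qone qmul.
Proof. by move=> p; quat_ring. Qed.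
Lemma qmulDl : left_distributive qmul +%R.
Proof. by move=> p q r; quat_ring. Qed.
Lemma qmulDr : right_distributive qmul +%R.
Proof. by move=> p q r; quat_ring. Qed.
Lemma qone_neq0 : qone != 0.
Proof. by apply/eqP => /(congr1 qscal)/eqP; rewrite oner_eq0. Qed.
Lemma qscaleAl (a : R) p q : a *: qmul p q = qmul (a *: p) q.
Proof. by quat_ring. Qed.
Lemma qscaleAr (a : R) p q : a *: qmul p q = qmul p (a *: q).
Proof. by quat_ring. Qed.

End Quaternions.

HB.instance Definition _ (R : realType) := GRing.Zmodule_isNzRing.Build (quat R)
  qmulA qmul1 qmulr1 qmulDl qmulDr qone_neq0.
HB.instance Definition _ (R : realType) :=
  GRing.Lmodule_isLalgebra.Build R (quat R) qscaleAl.
HB.instance Definition _ (R : realType) :=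
  GRing.Lalgebra_isAlgebra.Build R (quat R) qscaleAr.

(* The dual quaternion p + eps q, with eps ^ 2 = 0, primal part p and dual
   part q. As for [quat], the componentwise product is not used. *)
Definition dquat (R : realType) : Type := (quat R * quat R)%type.
HB.instance Definition _ (R : realType) := Vector.on (dquat R).

Section DualQuaternions.
Context {R : realType}.
Implicit Types h k : dquat R.

Definition DQuat (p q : quat R) : dquat R := (p, q).
Definition primal h : quat R := h.1.
Definition dual h : quat R := h.2.

Definition dqmul h k : dquat R :=
  DQuat (primal h * primal k) (primal h * dual k + dual h * primal k).
Definition dqone : dquat R := DQuat 1 0.
Definition dqconj h : dquat R := DQuat (qconj (primal h)) (qconj (dual h)).

Let primalD h k : primal (h + k) = primal h + primal k. Proof. by []. Qed.
Let dualD h k : dual (h + k) = dual h + dual k. Proof. by []. Qed.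
Let dquatP h k : primal h = primal k -> dual h = dual k -> h = k.
Proof. by case: h k => [? ?] [? ?]; rewrite /primal /dual /= => -> ->. Qed.

Lemma dqmulA : associative dqmul.
Proof.
move=> h k l; apply: dquatP; rewrite /dqmul /primal /dual /= ?mulrA //.
by rewrite mulrDr mulrDl !mulrA addrA.
Qed.
Lemma dqmul1 : left_id dqone dqmul.
Proof.
by move=> h; apply: dquatP; rewrite /dqmul /primal /dual /= ?mul1r // mul0r addr0.
Qed.
Lemma dqmulr1 : right_id dqone dqmul.
Proof.
by move=> h; apply: dquatP; rewrite /dqmul /primal /dual /= ?mulr1 // mulr0 add0r.
Qed.
Lemma dqmulDl : left_distributive dqmul +%R.
Proof.
move=> h k l; apply: dquatP; rewrite /dqmul ?(primalD, dualD) /primal /dual /= ?mulrDl //.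
by rewrite addrACA.
Qed.
Lemma dqmulDr : right_distributive dqmul +%R.
Proof.
move=> h k l; apply: dquatP; rewrite /dqmul ?(primalD, dualD) /primal /dual /= ?mulrDr //.
by rewrite addrACA.
Qed.
Lemma dqone_neq0 : dqone != 0.
Proof. by apply/eqP => /(congr1 primal)/eqP; rewrite oner_eq0. Qed.
Lemma dqscaleAl (a : R) h k : a *: dqmul h k = dqmul (a *: h) k.
Proof.
apply: dquatP; rewrite /primal /dual /= /primal /dual /= -?scalerAl //.
by rewrite scalerDr !scalerAl.
Qed.
Lemma dqscaleAr (a : R) h k : a *: dqmul h k = dqmul h (a *: k).
Proof.
apply: dquatP; rewrite /primal /dual /= /primal /dual /= -?scalerAr //.
by rewrite scalerDr !scalerAr.
Qed.

End DualQuaternions.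

HB.instance Definition _ (R : realType) := GRing.Zmodule_isNzRing.Build (dquat R)
  dqmulA dqmul1 dqmulr1 dqmulDl dqmulDr dqone_neq0.
HB.instance Definition _ (R : realType) :=
  GRing.Lmodule_isLalgebra.Build R (dquat R) dqscaleAl.
HB.instance Definition _ (R : realType) :=
  GRing.Lalgebra_isAlgebra.Build R (dquat R) dqscaleAr.

Section Kinematics.
Context {R : realType}.
Implicit Types (h : dquat R) (v d P Q : 'rV[R]_3) (a b c : set 'rV[R]_3).

(* Norm and trace lie in the dual numbers, i.e. the primal and dual parts of
   these dual quaternions have zero vectorial part. *)
Definition dqnorm h : dquat R := h * dqconj h.
Definition dqtrace h : dquat R := h + dqconj h.

(* A predicate on representatives; the Study quadric is the set of classes of
   the nonzero h that satisfy it. *)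
Definition study h : Prop := dual (dqnorm h) = 0.

Definition rotation_quat h : Prop :=
  [/\ h != 0, dual (dqnorm h) = 0, dual (dqtrace h) = 0 & qvec (primal h) != 0].

(* The scalar part of p v p^* + p q^* - q p^* is always 0. *)
Definition dqact h v : 'rV[R]_3 :=
  let p := primal h in let q := dual h in
  (qscal (p * qconj p))^-1 *:
    qvec (p * Quat 0 v * qconj p + p * qconj q - q * qconj p).

(* The rotation axis, as the set of fixed points of the rotation. *)
Definition axis h : set 'rV[R]_3 := [set v | dqact h v = v].

Definition compatible (h1 h2 : dquat R) : Prop := axis h1 = axis h2.

(* [is_direction d a]: a is a line and d is a direction vector of a. *)
Definition is_direction d a : Prop :=
  d != 0 /\ exists P, a = [set P + t *: d | t in [set: R]].

(* Coincident lines count as parallel. *)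
Definition concurrent (lines : set (set 'rV[R]_3)) : Prop :=
  (exists d, forall a, lines a -> is_direction d a) \/
  (exists P, forall a, lines a -> a P).

Definition perpendicular a b : Prop :=
  exists d e, [/\ is_direction d a, is_direction e b & dotv d e = 0].

(* c meets a in Q and b in P, and is perpendicular to both. *)
Definition common_perpendicular c a Q b P : Prop :=
  [/\ perpendicular c a, perpendicular c b, (a `&` c) Q & (b `&` c) P].

(* [normal_foot a b P]: P is the normal foot of a on b. It is unique when a and
   b are not parallel. *)
Definition normal_foot a b P : Prop :=
  exists c Q, common_perpendicular c a Q b P.

(* [normal_distance a b x]: x is the length of the common perpendicular. *)
Definition normal_distance a b (x : R) : Prop :=
  exists c Q P, common_perpendicular c a Q b P /\ x = normv (P - Q).

(* Lines are not oriented, so their angle is taken in [0, pi / 2]. *)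
Definition normal_angle a b (alpha : R) : Prop :=
  0 <= alpha <= pi / 2%:R /\
  exists d e, [/\ is_direction d a, is_direction e b &
    dotv d e = normv d * normv e * cos alpha].

(* Both sines are required to be nonzero, so that the quotients are meaningful
   and the normal feet are unique. *)
Definition bennett_conditions a1 a2 a3 : Prop :=
  (exists P, normal_foot a1 a2 P /\ normal_foot a3 a2 P) /\
  exists d12 d23 alpha12 alpha23 : R,
    [/\ normal_distance a1 a2 d12 /\ normal_distance a2 a3 d23,
        normal_angle a1 a2 alpha12 /\ normal_angle a2 a3 alpha23,
        sin alpha12 != 0 /\ sin alpha23 != 0 &
        d12 / sin alpha12 = d23 / sin alpha23].

(* The span of the products h_(k_1) * ... * h_(k_s), i <= k_1 < ... < k_s <= j:
   the subsequences of i, ..., j are enumerated by boolean masks. *)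
Definition coupling_space (h : nat -> dquat R) (i j : nat) : {vspace dquat R} :=
  let idx := index_iota i j.+1 in
  <<[seq \prod_(k <- mask m idx) h k | m : (size idx).-tuple bool]>>%VS.

Definition coupling_dim (h : nat -> dquat R) (i j : nat) : nat :=
  \dim (coupling_space h i j).

End Kinematics.

(* Main.v *)
Require Import Defs.
From HB Require Import structures.
From mathcomp Require Import all_boot all_order all_algebra.
From mathcomp Require Import boolp classical_sets reals trigo.
From mathcomp Require Import ring lra.

(** Each rotation quaternion is an affine function, with real coefficients, of the
    half-turn [a = u + eps q] about its axis, where [u] is the unit direction and [q]
    the moment of the axis ([rotation_quat_unit]); this does not change the coupling
    spaces ([coupling_space_affine]), and now [a * a = -1].

    a) The coupling space of [a_1, .., a_i] is stable under right multiplication by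
    [a_i], a complex structure, so that its dimension is even
    ([even_dim_complex_structure]).

    b) The coupling space of [a] and [b] is spanned by [1], [a], [b], [a * b]. These
    are independent unless [b] lies in the field [R[a]], that is unless the axes
    coincide. The dual part of the norm of a combination of them is a nonzero
    quadratic form times the reciprocal product of the axes ([study_comb]), and the
    reciprocal product vanishes exactly for parallel or meeting lines
    ([concurrent2]).

    c) In dimension 4 the coupling spaces of the first two and of the last two
    half-turns coincide. Hence the space contains the anticommutator of [a] and [b],
    whose dual part is -2 times the reciprocal product; this must be 0, and [c] is a real
    combination of [a], [b] and their cross product ([four_dim_concurrent]).

    d) In dimension 6 there is a nonzero [m] in the span of [1], [a], [b], [a * b]
    with [a * m = m * c] or [a * m = - m * c] ([intertwiner]). Reorienting the third
    axis, assume the first. Over the complex numbers, [m] acts between the rank one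
    elements [a - i] and [c + i] as a complex combination of [1] and [b] without dual
    part. Taking the component along an eigenvector of [b] shows that the ratio of
    the two dual half-angle tangents that [a] and [c] make with [b], times the
    exponential of [i] times the dual angle between the common normals, is an
    ordinary complex number ([primal_relation], [dual_relation]). The vanishing of
    its logarithmic derivative in the dual direction consists of the two Bennett
    conditions: the real part is the equality of the ratios of distance and sine,
    the imaginary part the coincidence of the normal feet ([half_tangent_rigidity],
    [bennett_core]). Parallel consecutive axes are excluded separately
    ([intertwiner_parallel12], [intertwiner_parallel23]). *)

Set Implicit Arguments.
Unset Strict Implicit.
Unset Printing Implicit Defensive.

Import Order.TTheory GRing.Theory Num.Theory.
Local Open Scope classical_set_scope.
Local Open Scope ring_scope.

(** * Vectors of three-space *)

Section Vectors.
Context {R : realType}.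
Implicit Types u v w : 'rV[R]_3.

Lemma dotvE u v : dotv u v = u 0 0 * v 0 0 + u 0 1 * v 0 1 + u 0 2%:R * v 0 2%:R.
Proof. exact: sumI3. Qed.

Lemma crossv0 u v : crossv u v 0 0 = u 0 1 * v 0 2%:R - u 0 2%:R * v 0 1.
Proof. by rewrite mxE; congr (u _ _ * v _ _ - u _ _ * v _ _); apply/val_inj. Qed.
Lemma crossv1 u v : crossv u v 0 1 = u 0 2%:R * v 0 0 - u 0 0 * v 0 2%:R.
Proof. by rewrite mxE; congr (u _ _ * v _ _ - u _ _ * v _ _); apply/val_inj. Qed.
Lemma crossv2 u v : crossv u v 0 2%:R = u 0 0 * v 0 1 - u 0 1 * v 0 0.
Proof. by rewrite mxE; congr (u _ _ * v _ _ - u _ _ * v _ _); apply/val_inj. Qed.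

Lemma vec3P u v : [/\ u 0 0 = v 0 0, u 0 1 = v 0 1 & u 0 2%:R = v 0 2%:R] -> u = v.
Proof. by case=> e0 e1 e2; apply/rowP; apply: I3P. Qed.

Lemma addvE u v i : (u + v) 0 i = u 0 i + v 0 i. Proof. by rewrite mxE. Qed.
Lemma oppvE u i : (- u) 0 i = - u 0 i. Proof. by rewrite mxE. Qed.
Lemma scalevE (t : R) u i : (t *: u) 0 i = t * u 0 i. Proof. by rewrite mxE. Qed.
Lemma zerovE i : (0 : 'rV[R]_3) 0 i = 0. Proof. by rewrite mxE. Qed.

(** Expands coordinates without unfolding [crossv] by [mxE], whose cyclic index
    arithmetic would block [ring]. *)
Definition coordE := (crossv0, crossv1, crossv2, addvE, oppvE, scalevE, zerovE, dotvE).

End Vectors.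

Ltac coords := rewrite ?coordE.
Ltac vec_ring := apply: vec3P; split; coords; ring.
Ltac scal_ring := coords; ring.

Section VectorIdentities.
Context {R : realType}.
Implicit Types u v w : 'rV[R]_3.

Lemma dotvC u v : dotv u v = dotv v u. Proof. scal_ring. Qed.
Lemma dotvZl t u v : dotv (t *: u) v = t * dotv u v. Proof. scal_ring. Qed.
Lemma dotvZr t u v : dotv u (t *: v) = t * dotv u v. Proof. scal_ring. Qed.
Lemma crossvDr u v w : crossv w (u + v) = crossv w u + crossv w v. Proof. vec_ring. Qed.
Lemma crossvZr t u v : crossv u (t *: v) = t *: crossv u v. Proof. vec_ring. Qed.
Lemma crossvZl t u v : crossv (t *: u) v = t *: crossv u v. Proof. vec_ring. Qed.
Lemma crossvv u : crossv u u = 0. Proof. vec_ring. Qed.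

Lemma dotv_gt0 u : u != 0 -> 0 < dotv u u.
Proof.
move=> u0; have : 0 <= dotv u u by rewrite dotvE -!expr2 !addr_ge0 ?sqr_ge0.
rewrite le_eqVlt => /orP[|//]; rewrite dotvE -!expr2 eq_sym.
rewrite !paddr_eq0 ?addr_ge0 ?sqr_ge0 // !sqrf_eq0.
case/andP=> /andP[/eqP e0 /eqP e1] /eqP e2; case/eqP: u0.
by apply: vec3P; rewrite !zerovE.
Qed.

Lemma dotv_eq0 u : dotv u u = 0 -> u = 0.
Proof. by move=> e; apply/eqP/negPn/negP => /dotv_gt0; rewrite e ltxx. Qed.

Lemma unit_neq0 u : dotv u u = 1 -> u != 0.
Proof.
move=> u1; apply/eqP => u0; move/eqP: u1.
by rewrite u0 dotvE !zerovE !mulr0 !addr0 eq_sym oner_eq0.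
Qed.

Lemma dotv_crossv u v : dotv (crossv u v) (crossv u v) = dotv u u * dotv v v - dotv u v ^+ 2.
Proof. scal_ring. Qed.

Lemma double_crossv u v w : crossv u (crossv v w) = dotv u w *: v - dotv u v *: w.
Proof. vec_ring. Qed.

(** The expansion of [w] in the basis [u], [v], [crossv u v], with its denominator
    cleared. *)
Lemma cross_frame u v w : let n := crossv u v in
  dotv n n *: w = dotv (crossv w v) n *: u + dotv (crossv u w) n *: v + dotv w n *: n.
Proof. rewrite /=; vec_ring. Qed.

Lemma crossv_eq0 u v : u != 0 -> crossv u v = 0 -> v = (dotv u v / dotv u u) *: u.
Proof.
move=> u0 uv; have := double_crossv u u v.
rewrite uv -{1}(scale0r 0) crossvZr scale0r => /esym/eqP; rewrite subr_eq0 => /eqP e.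
have d0 := lt0r_neq0 (dotv_gt0 u0).
by rewrite mulrC -scalerA e scalerA mulVf // scale1r.
Qed.

Lemma collinear u v : u != 0 -> v != 0 -> crossv u v = 0 ->
  exists2 t, t != 0 & v = t *: u.
Proof.
move=> u0 v0 uv; exists (dotv u v / dotv u u); last exact: crossv_eq0.
by apply: contra_neq v0 => t0; rewrite (crossv_eq0 u0 uv) t0 scale0r.
Qed.

End VectorIdentities.

(** * Lines in Pluecker coordinates, and rotation axes *)

Section Lines.
Context {R : realType}.
Implicit Types (u q v d P : 'rV[R]_3) (h : dquat R).

(** The line with direction [u] and moment [q]. With this sign of the moment, the
    fixed points of the rotation with primal vector [u] and dual vector [q] form
    [plucker_line u q]. *)
Definition plucker_line u q : set 'rV[R]_3 := [set v | crossv u v = q].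

Lemma plucker_point u q : u != 0 -> dotv u q = 0 -> exists P, crossv u P = q.
Proof.
move=> /dotv_gt0/lt0r_neq0 n0 uq; exists ((dotv u u)^-1 *: crossv q u).
by rewrite crossvZr double_crossv uq scale0r subr0 scalerA mulVf // scale1r.
Qed.

Lemma plucker_lineE u P :
  u != 0 -> plucker_line u (crossv u P) = [set P + t *: u | t in [set: R]].
Proof.
move=> u0; apply/seteqP; split => v /=; rewrite /plucker_line /=.
- move=> e; exists (dotv u (v - P) / dotv u u) => //.
  rewrite -crossv_eq0 ?subrKC //.
  by rewrite crossvDr -scaleN1r crossvZr e scaleN1r subrr.
- by case=> t _ <-; rewrite crossvDr crossvZr crossvv scaler0 addr0.
Qed.

Lemma plucker_line_direction u q t :
  u != 0 -> dotv u q = 0 -> t != 0 -> is_direction (t *: u) (plucker_line u q).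
Proof.
move=> u0 uq t0; split; first by rewrite scaler_eq0 negb_or t0.
have [P <-] := plucker_point u0 uq; exists P; rewrite plucker_lineE //.
apply/seteqP; split => v [x _ <-].
- by exists (x / t); rewrite // scalerA divfK.
- by exists (x * t); rewrite // scalerA.
Qed.

Lemma direction_plucker_line d u q :
  is_direction d (plucker_line u q) -> crossv u d = 0.
Proof.
move=> [_ [P eP]].
have eQ : plucker_line u q (P + d) by rewrite eP; exists 1; rewrite // scale1r.
have eq : plucker_line u q P by rewrite eP; exists 0; rewrite // scale0r addr0.
by apply: (addrI (crossv u P)); rewrite -crossvDr addr0 eQ eq.
Qed.

Lemma plucker_lineZ t u q : t != 0 -> plucker_line (t *: u) (t *: q) = plucker_line u q.
Proof.
move=> t0; apply/seteqP; split=> v; rewrite /plucker_line /= crossvZl.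
  exact: scalerI.
by move=> ->.
Qed.

(** Realness of the trace kills the dual scalar part; realness of the norm then
    leaves the Pluecker relation between the two vectorial parts. *)
Lemma rotation_quatP h : rotation_quat h ->
  [/\ qvec (primal h) != 0, qscal (dual h) = 0 &
      dotv (qvec (primal h)) (qvec (dual h)) = 0].
Proof.
case=> _ /(congr1 qscal) nrm /(congr1 qscal) tr u0.
have s0 : qscal (dual h) = 0.
  by move: tr; rewrite /= /qscal /= => tr; lra.
split=> //; move: nrm; rewrite /dqnorm /dqconj /= /qscal /=.
rewrite -/(qscal _) -/(qscal _) s0.
set u := qvec _; set q := qvec _ => nrm.
have : dotv u (- q) = - dotv u q by scal_ring.
have : dotv q (- u) = - dotv u q by scal_ring.
move=> e1 e2; rewrite e1 e2 in nrm; lra.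
Qed.

(** With [w = crossv u v - q], the displacement of [v] is a nonzero multiple of
    [crossv u w + s *: w], where [s] is the scalar part. It vanishes only for
    [w = 0]: pairing it with [w] gives [s * dotv w w = 0], and for a half-turn
    ([s = 0]) [w] is both parallel and orthogonal to [u]. *)
Lemma axisE h : rotation_quat h ->
  axis h = plucker_line (qvec (primal h)) (qvec (dual h)).
Proof.
move=> /rotation_quatP[].
case: h => [[s u] [s' q]]; rewrite /primal /dual /qvec /qscal /= => u0 -> uq {s'}.
have N0 : s ^+ 2 + dotv u u != 0.
  by rewrite lt0r_neq0 // ltr_wpDl ?sqr_ge0 ?dotv_gt0.
have actE v : dqact ((s, u), (0, q)) v - v =
    (2%:R / (s ^+ 2 + dotv u u)) *:
      (crossv u (crossv u v - q) + s *: (crossv u v - q)).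
  have numE : dqact ((s, u), (0, q)) v = (s ^+ 2 + dotv u u)^-1 *:
      ((s ^+ 2 - dotv u u) *: v + (2%:R * dotv u v) *: u +
       (2%:R * s) *: (crossv u v - q) - 2%:R *: crossv u q).
    rewrite /dqact /primal /dual /= /qscal /qvec /= /qscal /qvec /=.
    congr (_^-1 *: _); first by rewrite /qscal /qvec /=; scal_ring.
    rewrite /qscal /qvec /=; vec_ring.
  rewrite numE.
  move: N0; rewrite !coordE => N0; apply: vec3P; split; rewrite ?coordE; field; exact: N0.
have c0 : 2%:R / (s ^+ 2 + dotv u u) != 0.
  by rewrite mulf_neq0 ?invr_neq0 ?pnatr_eq0.
apply/seteqP; split=> v; rewrite /axis /plucker_line /= => e; last first.
  by apply/eqP; rewrite -subr_eq0 actE e subrr; apply/eqP; vec_ring.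
set w := crossv u v - q in actE; suff w0 : w = 0 by apply/eqP; rewrite -subr_eq0 -/w w0.
have uw : dotv u w = 0.
  by transitivity (- dotv u q); [rewrite /w; scal_ring|rewrite uq oppr0].
move/eqP: (actE v); rewrite e subrr eq_sym scaler_eq0 (negPf c0) /= -/w => /eqP ew.
have : s * dotv w w = 0.
  have -> : s * dotv w w = dotv w (crossv u w + s *: w) by scal_ring.
  by rewrite ew; scal_ring.
move=> /eqP; rewrite mulf_eq0 => /orP[/eqP s0|/eqP]; last exact: dotv_eq0.
by rewrite (@crossv_eq0 _ u w) ?uw ?mul0r ?scale0r // -ew s0 scale0r addr0.
Qed.

End Lines.

(** * Common perpendiculars and concurrency *)

Section Pairs.
Context {R : realType}.
Implicit Types (u q v d P F : 'rV[R]_3).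

(** The reciprocal product of two lines, that is the dual part of the scalar
    product of the dual vectors [u + eps q] and [v + eps r]. *)
Definition reciprocal u q v r : R := dotv u r + dotv q v.

(** [F] is the foot on the second line of its common perpendicular with the first,
    and [x *: crossv u v] leads from [F] to the other foot. Such adapted
    coordinates replace the choice of a moving frame in everything that follows.
    They come from expanding the difference of a point of each line in the basis
    [u], [v], [crossv u v]. *)
Lemma normal_feet u q v r : crossv u v != 0 -> u != 0 -> v != 0 ->
  dotv u q = 0 -> dotv v r = 0 ->
  exists F x, q = crossv u (F + x *: crossv u v) /\ r = crossv v F.
Proof.
move=> uv u0 v0 /(plucker_point u0)[P eP] /(plucker_point v0)[Q eQ].
set n := crossv u v; set nn := dotv n n.
have nn0 : nn != 0 by rewrite lt0r_neq0 // dotv_gt0.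
set w := P - Q; set x := dotv w n / nn.
set y := dotv (crossv w v) n / nn; set z := dotv (crossv u w) n / nn.
have ew : w = y *: u + z *: v + x *: n.
  apply: (scalerI nn0); rewrite /nn /n cross_frame -/n -/nn !scalerDr !scalerA.
  by rewrite /x /y /z !mulrA !(mulrC nn) !mulfK.
exists (Q + z *: v), x; split.
  rewrite -eP -(subrK Q P) -/w ew; rewrite /n; vec_ring.
by rewrite -eQ crossvDr crossvZr crossvv scaler0 addr0.
Qed.

Lemma reciprocal_feet u v F x :
  reciprocal u (crossv u (F + x *: crossv u v)) v (crossv v F) =
  - x * dotv (crossv u v) (crossv u v).
Proof. rewrite /reciprocal; scal_ring. Qed.

(** For two non-parallel lines, the reciprocal product and the displacement between
    the feet are both proportional to the [x] of [normal_feet], by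
    [reciprocal_feet]; parallel lines have reciprocal product 0. *)
Lemma concurrent2 u q v r : u != 0 -> v != 0 -> dotv u q = 0 -> dotv v r = 0 ->
  concurrent [set plucker_line u q; plucker_line v r] <-> reciprocal u q v r = 0.
Proof.
move=> u0 v0 uq vr; split.
- case=> [[d dir]|[P meet]].
  + have /direction_plucker_line ud := dir _ (or_introl erefl).
    have /direction_plucker_line vd := dir _ (or_intror erefl).
    have [d0 _] := dir _ (or_introl erefl).
    have [t t0 e] : exists2 t, t != 0 & u = t *: d.
      apply: collinear => //; transitivity (- crossv u d); first by vec_ring.
      by rewrite ud oppr0.
    have [s s0 f] : exists2 s, s != 0 & v = s *: d.
      apply: collinear => //; transitivity (- crossv v d); first by vec_ring.
      by rewrite vd oppr0.
    move: uq; rewrite /reciprocal e f !dotvZl => /eqP.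
    rewrite mulf_eq0 (negPf t0) => /eqP dq; move: vr; rewrite f dotvZl => /eqP.
    rewrite mulf_eq0 (negPf s0) => /eqP dr.
    by rewrite dr dotvZr dotvC dq !mulr0 addr0.
  + have <- : crossv u P = q by apply: (meet _ (or_introl erefl)).
    have <- : crossv v P = r by apply: (meet _ (or_intror erefl)).
    rewrite /reciprocal; scal_ring.
- move=> rec0; have [uv|uv] := eqVneq (crossv u v) 0.
  + left; have [t t0 e] := collinear u0 v0 uv.
    exists v => _ [|] ->; first by rewrite e; exact: plucker_line_direction.
    by rewrite -{1}(scale1r v); apply: plucker_line_direction; rewrite // oner_eq0.
  + right; have [F [x [eq er]]] := normal_feet uv u0 v0 uq vr.
    move: rec0; rewrite {1}er {1}eq reciprocal_feet => /eqP.
    rewrite mulf_eq0 oppr_eq0 (negPf (lt0r_neq0 (dotv_gt0 uv))) orbF => /eqP x0.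
    exists F => _ [|] ->; rewrite /plucker_line /= ?er //.
    by rewrite eq x0 scale0r addr0.
Qed.

(** The third line is a linear combination of the first two and of their dual cross
    product. Parallel lines have a cross product with zero primal part; for lines
    through a point [F] it is a line through [F]. *)
Lemma concurrent3 (x y z : R) u q v r w s :
  u != 0 -> v != 0 -> w != 0 -> dotv u q = 0 -> dotv v r = 0 -> dotv w s = 0 ->
  reciprocal u q v r = 0 ->
  w = x *: u + y *: v + z *: crossv u v ->
  s = x *: q + y *: r + z *: (crossv u r + crossv q v) ->
  concurrent [set plucker_line u q; plucker_line v r; plucker_line w s].
Proof.
move=> u0 v0 w0 uq vr ws rec0 ew es; have [uv|uv] := eqVneq (crossv u v) 0.
- left; exists u.
  have dir v1 r1 : v1 != 0 -> dotv v1 r1 = 0 -> crossv u v1 = 0 ->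
    is_direction u (plucker_line v1 r1).
    move=> v10 vr1 /(collinear u0 v10)[t t0 e].
    have -> : u = t^-1 *: v1 by rewrite e scalerA mulVf // scale1r.
    by apply: plucker_line_direction; rewrite ?invr_neq0.
  move=> _ [[|]|] ->; apply: dir => //; first exact: crossvv.
  by rewrite ew uv scaler0 addr0 crossvDr !crossvZr uv crossvv !scaler0 addr0.
- right; have [F [k [eq er]]] := normal_feet uv u0 v0 uq vr.
  move: rec0; rewrite {1}er {1}eq reciprocal_feet => /eqP.
  rewrite mulf_eq0 oppr_eq0 (negPf (lt0r_neq0 (dotv_gt0 uv))) orbF => /eqP x0.
  rewrite x0 scale0r addr0 in eq.
  exists F => _ [[|]|] ->; rewrite /plucker_line /= ?er //.
  by rewrite es eq er ew; vec_ring.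
Qed.

Lemma normal_line u v F x : crossv u v != 0 -> u != 0 -> v != 0 ->
  common_perpendicular [set F + t *: crossv u v | t in [set: R]]
    (plucker_line u (crossv u (F + x *: crossv u v))) (F + x *: crossv u v)
    (plucker_line v (crossv v F)) F.
Proof.
move=> uv u0 v0.
have dc : is_direction (crossv u v) [set F + t *: crossv u v | t in [set: R]].
  by split=> //; exists F.
have du : is_direction u (plucker_line u (crossv u (F + x *: crossv u v))).
  by split=> //; eexists; apply: plucker_lineE.
have dv : is_direction v (plucker_line v (crossv v F)).
  by split=> //; eexists; apply: plucker_lineE.
split.
- by exists (crossv u v), u; split=> //; scal_ring.
- by exists (crossv u v), v; split=> //; scal_ring.
- by split=> //; exists x.
- by split=> //; exists 0; rewrite // scale0r addr0.
Qed.

(** The absolute value makes this the angle of unoriented lines, between 0 and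
    [pi / 2]. *)
Definition line_angle u v : R := acos `|dotv u v|.

Section Angle.
Variables (u v : 'rV[R]_3).
Hypotheses (u1 : dotv u u = 1) (v1 : dotv v v = 1).

Lemma dotv_sqr : dotv u v ^+ 2 = 1 - dotv (crossv u v) (crossv u v).
Proof. by rewrite dotv_crossv u1 v1; ring. Qed.

Lemma dotv_norm_itv : -1 <= `|dotv u v| <= 1.
Proof.
rewrite (le_trans _ (normr_ge0 _)) ?lerN10 //=.
rewrite -(@ler_pXn2r _ 2) ?nnegrE // expr1n real_normK ?num_real // dotv_sqr.
by rewrite lerBlDr lerDl dotvE -!expr2 !addr_ge0 ?sqr_ge0.
Qed.

Lemma cos_line_angle : cos (line_angle u v) = `|dotv u v|.
Proof. by rewrite /line_angle acosK // in_itv; exact: dotv_norm_itv. Qed.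

Lemma sin_line_angle : sin (line_angle u v) = normv (crossv u v).
Proof.
rewrite /line_angle sin_acos ?dotv_norm_itv // /normv; congr Num.sqrt.
by rewrite real_normK ?num_real // dotv_sqr; ring.
Qed.

Lemma line_angleP q r : dotv u q = 0 -> dotv v r = 0 ->
  normal_angle (plucker_line u q) (plucker_line v r) (line_angle u v).
Proof.
move=> uq vr.
have [u0 v0] := (unit_neq0 u1, unit_neq0 v1).
have unitE (w : 'rV[R]_3) : dotv w w = 1 -> normv w = 1 by rewrite /normv => ->; exact: sqrtr1.
split.
  have itv := dotv_norm_itv; rewrite acos_ge0 //=.
  rewrite leNgt; apply/negP => lt.
  have : cos (line_angle u v) < 0.
    rewrite -(subrK (pi / 2%:R) (line_angle u v)) cosDpihalf oppr_lt0.
    rewrite sin_gt0_pi // subr_gt0 lt /= ltrBlDr.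
    apply: le_lt_trans (acos_lepi itv) _; rewrite ltrDl.
    by rewrite divr_gt0 ?pi_gt0 ?ltr0n.
  by rewrite cos_line_angle ltNge normr_ge0.
have diru : is_direction u (plucker_line u q).
  by have := plucker_line_direction u0 uq (oner_neq0 R); rewrite scale1r.
have dirv : is_direction v (plucker_line v r).
  by have := plucker_line_direction v0 vr (oner_neq0 R); rewrite scale1r.
have [dge|dlt] := leP 0 (dotv u v).
- exists u, v; split=> //.
  by rewrite !unitE // cos_line_angle !mul1r ger0_norm.
- exists u, ((-1) *: v); split=> //.
    by apply: plucker_line_direction; rewrite ?oppr_eq0 ?oner_eq0.
  have vN1 : dotv ((-1) *: v) ((-1) *: v) = 1 by rewrite dotvZl dotvZr v1; ring.
  rewrite (unitE u) // (unitE (-1 *: v)) // cos_line_angle !mul1r.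
  by rewrite ltr0_norm // dotvZr mulN1r.
Qed.

End Angle.

Lemma normvZ t u : normv (t *: u) = `|t| * normv u.
Proof.
by rewrite /normv dotvZl dotvZr mulrA -expr2 sqrtrM ?sqr_ge0 // sqrtr_sqr.
Qed.

Lemma normvC u v : normv (crossv u v) = normv (crossv v u).
Proof. by rewrite /normv; congr Num.sqrt; scal_ring. Qed.

Lemma common_perpendicularC c a Q b P :
  common_perpendicular c a Q b P -> common_perpendicular c b P a Q.
Proof. by case. Qed.

(** In adapted coordinates the normal distances are [`|x|] and [`|y|] times the
    sines of the angles, so the Bennett conditions amount to a common foot [F] and
    [`|x| = `|y|]. *)
Lemma bennett_of_feet u v w F x y :
  dotv u u = 1 -> dotv v v = 1 -> dotv w w = 1 ->
  crossv u v != 0 -> crossv w v != 0 -> `|x| = `|y| ->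
  bennett_conditions (plucker_line u (crossv u (F + x *: crossv u v)))
    (plucker_line v (crossv v F))
    (plucker_line w (crossv w (F + y *: crossv w v))).
Proof.
move=> u1 v1 w1 uv wv xy.
have neq0l (a b : 'rV[R]_3) : crossv a b != 0 -> a != 0.
  by apply: contra_neq => ->; vec_ring.
have neq0r (a b : 'rV[R]_3) : crossv a b != 0 -> b != 0.
  by apply: contra_neq => ->; vec_ring.
have [u0 [v0 w0]] := (neq0l _ _ uv, (neq0r _ _ uv, neq0l _ _ wv)).
have cp1 := normal_line F x uv u0 v0.
have cp2 := normal_line F y wv w0 v0.
have nrm0 (a : 'rV[R]_3) : a != 0 -> normv a != 0.
  by move=> a0; rewrite /normv lt0r_neq0 // sqrtr_gt0 dotv_gt0.
have wvN : crossv v w != 0.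
  by apply: contra_neq wv => e; transitivity (- crossv v w); [vec_ring|rewrite e oppr0].
have orth (a c : 'rV[R]_3) : dotv a (crossv a c) = 0 by scal_ring.
split.
  by exists F; split; eexists; eexists; [exact: cp1|exact: cp2].
exists (`|x| * normv (crossv u v)), (`|y| * normv (crossv w v)).
exists (line_angle u v), (line_angle v w); split.
- split.
  + eexists; eexists; eexists; split; first exact: cp1.
    by rewrite opprD addNKr -scaleNr normvZ normrN.
  + eexists; eexists; eexists; split; first exact: (common_perpendicularC cp2).
    by rewrite [F + _]addrC addrK normvZ.
- by split; apply: line_angleP; rewrite ?orth.
- by rewrite !sin_line_angle ?nrm0.
- rewrite !sin_line_angle // (normvC v w) !mulfK ?nrm0 //.
Qed.

End Pairs.

(** * Coupling spaces *)

(** The matrix [M] of [J] on [U] satisfies [M ^+ 2 = -1], so that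
    [(\det M) ^+ 2 = (-1) ^+ \dim U], which is impossible in odd dimension. *)
Lemma even_dim_complex_structure (R : realFieldType) (vT : vectType R)
    (J : 'End(vT)) (U : {vspace vT}) :
  (J @: U <= U)%VS -> {in U, forall v, J (J v) = - v} -> ~~ odd (\dim U).
Proof.
move=> /subvP stab JJ; set n := \dim U; set b := vbasis U.
pose M : 'M[R]_n := \matrix_(i, j) coord b j (J b`_i).
have bU (i : 'I_n) : b`_i \in U by apply: vbasis_mem; rewrite mem_nth // size_tuple.
have JE (i : 'I_n) : J b`_i = \sum_j M i j *: b`_j.
  rewrite {1}(coord_vbasis (stab _ (memv_img J (bU i)))).
  by apply: eq_bigr => j _; rewrite mxE.
have MM : M *m M = (-1)%:M.
  apply/matrixP => i j; rewrite !mxE.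
  have -> : \sum_k M i k * M k j = coord b j (J (J b`_i)).
    rewrite [in RHS]JE linear_sum /= linear_sum /=; apply: eq_bigr => k _.
    by rewrite !linearZ /= [M k j]mxE.
  rewrite JJ // linearN /= coord_free ?(basis_free (vbasisP U)) //.
  by rewrite mulNrn.
apply/negP => oddn; have := congr1 determinant MM.
rewrite det_mulmx det_scalar -/n -signr_odd oddn expr1 -expr2 => sq.
by have := sqr_ge0 (\det M); rewrite sq oppr_ge0 ler10.
Qed.

Section Coupling.
Context {R : realType}.
Implicit Types (h a : nat -> dquat R) (s : seq nat) (k : nat) (U : {vspace dquat R}).

Definition rmul (x : dquat R) : 'End(dquat R) := linfun (x \o* idfun).

Lemma rmulE x y : rmul x y = y * x. Proof. by rewrite lfunE. Qed.

(** [coupling_space] for an arbitrary list of indices, which makes induction on the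
    list possible. *)
Definition product_span h s : {vspace dquat R} :=
  <<[seq \prod_(k <- mask m s) h k | m : (size s).-tuple bool]>>%VS.

Lemma mem_product_span h s (m : bitseq) :
  size m = size s -> \prod_(k <- mask m s) h k \in product_span h s.
Proof.
move=> /eqP sm; apply: memv_span.
by apply/mapP; exists (Tuple sm); rewrite ?mem_enum.
Qed.

Lemma product_span_rcons h s k :
  product_span h (rcons s k) =
  (product_span h s + rmul (h k) @: product_span h s)%VS.
Proof.
apply/eqP; rewrite eqEsubv subv_add; apply/andP; split; last (apply/andP; split).
- apply/span_subvP => _ /mapP[m _ ->].
  case/lastP: {m}(val m) (size_tuple m) => [|m c]; rewrite !size_rcons // => -[sm].
  rewrite mask_rcons //; case: c => /=.
  + rewrite cats1 big_rcons /= -rmulE; apply: subvP (addvSr _ _) _ _.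
    by apply: memv_img; apply: mem_product_span.
  + by rewrite cats0; apply: subvP (addvSl _ _) _ _; apply: mem_product_span.
- apply/span_subvP => _ /mapP[m _ ->].
  rewrite (_ : mask m s = mask (rcons m false) (rcons s k)); last first.
    by rewrite mask_rcons ?size_tuple //= cats0.
  by apply: mem_product_span; rewrite !size_rcons size_tuple.
- rewrite limg_span; apply/span_subvP => _ /mapP[_ /mapP[m _ ->] ->].
  rewrite rmulE (_ : _ * h k = \prod_(k <- mask (rcons m true) (rcons s k)) h k).
    by apply: mem_product_span; rewrite !size_rcons size_tuple.
  by rewrite mask_rcons ?size_tuple //= cats1 big_rcons.
Qed.

Lemma coupling_space0 h : coupling_space h 1 0 = <[1 : dquat R]>%VS.
Proof.
apply/eqP; rewrite eqEsubv; apply/andP; split.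
  apply/span_subvP => _ /mapP[m _ ->].
  by rewrite mask0 big_nil memv_line.
rewrite -memvE; have := @mem_product_span h [::] [::] erefl.
by rewrite mask0 big_nil.
Qed.

Lemma coupling_spaceS h i : coupling_space h 1 i.+1 =
  (coupling_space h 1 i + rmul (h i.+1) @: coupling_space h 1 i)%VS.
Proof.
rewrite -product_span_rcons /coupling_space -/(product_span _ _).
congr product_span.
by rewrite /index_iota !subSS !subn0 -cats1 -[in LHS](addn1 i) iotaD add1n.
Qed.

(** [U + U * h = U + U * (s + t * h)] for [t != 0]. Thus each rotation quaternion
    may be replaced by a half-turn about the same axis. *)
Lemma coupling_space_affine h a i :
  (forall k, (1 <= k <= i)%N ->
    exists s t : R, t != 0 /\ h k = s%:A + t *: a k) ->
  coupling_space h 1 i = coupling_space a 1 i.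
Proof.
elim: i => [|i IH] eh; first by rewrite !coupling_space0.
rewrite !coupling_spaceS IH; last first.
  by move=> k /andP[k1 ki]; apply: eh; rewrite k1 ltnW.
have [s [t [t0 e]]] := eh i.+1 (leqnn _).
set U := coupling_space a 1 i.
have hE y : y * h i.+1 = s *: y + t *: (y * a i.+1).
  by rewrite e mulrDr -scalerAr mulr1 scalerAr.
have aE y : y * a i.+1 = - (t^-1 * s) *: y + t^-1 *: (y * h i.+1).
  by rewrite hE scalerDr !scalerA mulVf // scale1r scaleNr addKr.
apply/eqP; rewrite eqEsubv !subv_add !addvSl /=; apply/andP; split;
  apply/subvP => _ /memv_imgP[y Uy ->]; rewrite rmulE.
- rewrite hE; apply: memv_add; first exact: memvZ.
  by apply: memvZ; rewrite -rmulE memv_img.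
- rewrite aE; apply: memv_add; first exact: memvZ.
  by apply: memvZ; rewrite -rmulE memv_img.
Qed.

Lemma coupling_spaceM h i x : h i.+1 * h i.+1 = -1 ->
  x \in coupling_space h 1 i.+1 -> x * h i.+1 \in coupling_space h 1 i.+1.
Proof.
move=> sq; rewrite coupling_spaceS => /memv_addP[y Uy [_ /memv_imgP[z Uz ->]]].
move->; rewrite rmulE mulrDl -mulrA sq mulrN1 addrC.
by apply: memv_add; rewrite ?memvN // -rmulE memv_img.
Qed.

Lemma even_coupling_dim h i : (1 <= i)%N -> h i * h i = -1 ->
  ~~ odd (coupling_dim h 1 i).
Proof.
case: i => // i _ sq; apply: (@even_dim_complex_structure _ _ (rmul (h i.+1))).
  apply/subvP => _ /memv_imgP[y Uy ->]; rewrite rmulE; exact: coupling_spaceM.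
by move=> y _; rewrite !rmulE -mulrA sq mulrN1.
Qed.

End Coupling.

(** * The span of 1, a, b and ab *)

Section BinaryAlgebra.
Variables (R : realType) (A : algType R) (a b : A).
Hypothesis sqa : a * a = -1.

(** For [a * a = -1] this is [alpha + beta * b] with [alpha] and [beta] in the
    copy [R[a]] of the complex numbers, see [combE]. *)
Definition comb (x0 x1 x2 x3 : R) : A :=
  x0%:A + x1 *: a + x2 *: b + x3 *: (a * b).

Lemma mul_line (x y z t : R) : (x%:A + y *: a) * (z%:A + t *: a) =
  (x * z - y * t)%:A + (x * t + y * z) *: a.
Proof.
rewrite mulrDl !mulrDr -!scalerAl -!scalerAr !mul1r !mulr1 sqa !scalerA.
by rewrite scalerN scalerBl scalerDl (addrC (_ *: a) (- _)) addrACA.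
Qed.

Lemma mull_comb x0 x1 x2 x3 : a * comb x0 x1 x2 x3 = comb (- x1) x0 (- x3) x2.
Proof.
rewrite /comb !mulrDr -!scalerAr mulr1 mulrA sqa mulN1r !scaleNr !scalerN.
by rewrite [x0 *: a + _]addrC -!addrA; congr (_ + (_ + _)); rewrite addrC.
Qed.

Lemma combE x0 x1 x2 x3 :
  comb x0 x1 x2 x3 = (x0%:A + x1 *: a) + (x2%:A + x3 *: a) * b.
Proof. by rewrite /comb mulrDl -!scalerAl mul1r addrA. Qed.

(** In [alpha + beta * b = 0], a nonzero [beta] is invertible in [R[a]], which would
    put [b] into [R[a]]. *)
Lemma comb_eq0 x0 x1 x2 x3 : (forall c d : R, b <> c%:A + d *: a) ->
  comb x0 x1 x2 x3 = 0 -> [/\ x0 = 0, x1 = 0, x2 = 0 & x3 = 0].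
Proof.
move=> nb.
have line0 (x y : R) : x%:A + y *: a = 0 -> x = 0 /\ y = 0.
  move=> e; have := mul_line x (- y) x y; rewrite e mulr0 => /esym.
  rewrite (_ : x * y + _ = 0); last by ring.
  rewrite scale0r addr0 => /eqP; rewrite scaler_eq0 oner_eq0 orbF => /eqP xy.
  have [hx hy] := (sqr_ge0 x, sqr_ge0 y).
  by split; apply/eqP; rewrite -sqrf_eq0; apply/eqP; lra.
rewrite combE => e.
have e2 : (x2 ^+ 2 + x3 ^+ 2) *: b =
    - (x2 * x0 + x3 * x1)%:A + - (x2 * x1 - x3 * x0) *: a.
  have := congr1 (fun z => (x2%:A + (- x3) *: a) * z) e.
  rewrite mulr0 mulrDr mulrA !mul_line.
  rewrite (_ : x2 * x3 + _ = 0); last by ring.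
  rewrite (_ : x2 * x2 - _ = x2 ^+ 2 + x3 ^+ 2); last by ring.
  rewrite scale0r addr0 -scalerAl mul1r addrC => /eqP.
  rewrite addr_eq0 => /eqP ->; rewrite opprD scaleNr !mulNr opprK.
  by [].
have [n0|n0] := eqVneq (x2 ^+ 2 + x3 ^+ 2) 0; last first.
  exfalso; apply: (nb (- (x2 * x0 + x3 * x1) / (x2 ^+ 2 + x3 ^+ 2))
                      (- (x2 * x1 - x3 * x0) / (x2 ^+ 2 + x3 ^+ 2))).
  apply: (scalerI n0); rewrite e2 scalerDr !scalerA !(mulrC _ (_ / _)) !divfK //.
  by rewrite !scaleNr.
move/eqP: n0; rewrite paddr_eq0 ?sqr_ge0 // !sqrf_eq0 => /andP[/eqP x20 /eqP x30].
move: e; rewrite x20 x30 !scale0r addr0 mul0r addr0 => /line0[-> ->].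
by [].
Qed.

End BinaryAlgebra.

Section RightMul.
Variables (R : realType) (A : algType R) (a b : A).

Lemma mulr_comb x0 x1 x2 x3 : b * b = -1 ->
  comb a b x0 x1 x2 x3 * b = comb a b (- x2) (- x3) x0 x1.
Proof.
move=> sqb; rewrite /comb !mulrDl -!scalerAl mul1r -mulrA sqb mulrN1 !scaleNr !scalerN.
by rewrite [LHS](ACl (3*4*1*2)).
Qed.

Lemma mulr_comb_first x0 x1 x2 x3 z : a * a = -1 -> b * a = z%:A - a * b ->
  comb a b x0 x1 x2 x3 * a = comb a b (- x1 + z * x2) (x0 + z * x3) x3 (- x2).
Proof.
move=> sqa ba; rewrite /comb !mulrDl -!scalerAl mul1r sqa -mulrA ba.
rewrite mulrBr mulrA sqa mulN1r opprK -scalerAr mulr1 !scalerDr !scalerDl !scaleNr.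
rewrite !scalerN !scalerA !(mulrC z).
by rewrite [LHS](AC (2*2*2) (2*3*(1*5)*6*4)).
Qed.

(** Right multiplication by [a] and by [b] preserves the span of [1], [a], [b] and
    [a * b] as soon as [a * b + b * a] is real, hence so does every element of it. *)
Lemma mul_comb x0 x1 x2 x3 y0 y1 y2 y3 z :
  a * a = -1 -> b * b = -1 -> b * a = z%:A - a * b ->
  comb a b x0 x1 x2 x3 * comb a b y0 y1 y2 y3 =
    y0 *: comb a b x0 x1 x2 x3 +
    y1 *: comb a b (- x1 + z * x2) (x0 + z * x3) x3 (- x2) +
    y2 *: comb a b (- x2) (- x3) x0 x1 +
    y3 *: comb a b (- x3) (- - x2) (- x1 + z * x2) (x0 + z * x3).
Proof.
move=> sqa sqb ba; rewrite {2}/comb !mulrDr -!scalerAr mulr1 mulrA.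
by rewrite !(mulr_comb_first _ _ _ _ sqa ba) !mulr_comb.
Qed.

Lemma combZD x0 x1 x2 x3 y0 y1 y2 y3 t :
  comb a b x0 x1 x2 x3 - t *: comb a b y0 y1 y2 y3 =
  comb a b (x0 - t * y0) (x1 - t * y1) (x2 - t * y2) (x3 - t * y3).
Proof.
rewrite /comb !scalerDr !scalerBl !scalerA !opprD.
by rewrite [LHS](AC (4*4) ((1*5)*(2*6)*(3*7)*(4*8))).
Qed.
End RightMul.

Section BinarySpan.
Context {R : realType}.
Implicit Types (a b : dquat R).

Definition binary_span a b : {vspace dquat R} := <<[:: 1; a; b; a * b]>>%VS.

Lemma binary_spanP a b x :
  reflect (exists x0 x1 x2 x3, x = comb a b x0 x1 x2 x3) (x \in binary_span a b).
Proof.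
apply: (iffP idP).
- rewrite /binary_span !span_cons span_nil addv0.
  case/memv_addP=> _ /vlineP[x0 ->] [_ /memv_addP[_ /vlineP[x1 ->]
    [_ /memv_addP[_ /vlineP[x2 ->] [_ /vlineP[x3 ->] ->]] ->]] ->].
  by exists x0, x1, x2, x3; rewrite /comb !addrA.
- case=> x0 [x1 [x2 [x3 ->]]]; rewrite /comb.
  by rewrite !memvD // memvZ // memv_span // !inE eqxx ?orbT.
Qed.

Lemma mull_binary_span a b x :
  a * a = -1 -> x \in binary_span a b -> a * x \in binary_span a b.
Proof.
move=> sqa /binary_spanP[x0 [x1 [x2 [x3 ->]]]]; rewrite mull_comb //.
by apply/binary_spanP; exists (- x1), x0, (- x3), x2.
Qed.

Lemma mul_binary_span a b z x y :
  a * a = -1 -> b * b = -1 -> b * a = z%:A - a * b ->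
  x \in binary_span a b -> y \in binary_span a b -> x * y \in binary_span a b.
Proof.
move=> sqa sqb ba /binary_spanP[x0 [x1 [x2 [x3 ->]]]].
case/binary_spanP=> y0 [y1 [y2 [y3 ->]]].
rewrite (mul_comb _ _ _ _ _ _ _ _ sqa sqb ba).
by rewrite !memvD // memvZ //; apply/binary_spanP; do 4!eexists.
Qed.

Lemma dim_binary_span a b : a * a = -1 -> (forall c d : R, b <> c%:A + d *: a) ->
  \dim (binary_span a b) = 4%N.
Proof.
move=> sqa nb; have fr : free [:: 1; a; b; a * b].
  apply/(@freeP _ _ 4 [tuple 1; a; b; a * b]) => k.
  rewrite !big_ord_recl big_ord0 addr0 /= => e.
  have [] := @comb_eq0 R _ a b sqa (k ord0) (k (lift ord0 ord0))
    (k (lift ord0 (lift ord0 ord0))) (k (lift ord0 (lift ord0 (lift ord0 ord0)))) nb.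
    by rewrite /comb -!addrA.
  move=> e0 e1 e2 e3 [[|[|[|[|//]]]] lti]; [rewrite -e0|rewrite -e1|rewrite -e2|rewrite -e3];
    congr k; exact/val_inj.
by have /eqP := fr.
Qed.

Lemma coupling_space2 h : coupling_space h 1 2 = binary_span (h 1%N) (h 2%N).
Proof.
rewrite coupling_spaceS coupling_spaceS coupling_space0.
rewrite /binary_span !span_cons span_nil addv0 addvA.
by rewrite limgD !limg_line !rmulE !mul1r addvA.
Qed.

End BinarySpan.

(** * Lines as dual quaternions *)

Section Components.
Context {R : realType}.
Implicit Types (p : quat R) (h k : dquat R) (t : R) (u v : 'rV[R]_3).

Lemma qscalD p p' : qscal (p + p') = qscal p + qscal p'. Proof. by []. Qed.
Lemma qvecD p p' : qvec (p + p') = qvec p + qvec p'. Proof. by []. Qed.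
Lemma qscalN p : qscal (- p) = - qscal p. Proof. by []. Qed.
Lemma qvecN p : qvec (- p) = - qvec p. Proof. by []. Qed.
Lemma qscalZ t p : qscal (t *: p) = t * qscal p. Proof. by []. Qed.
Lemma qvecZ t p : qvec (t *: p) = t *: qvec p. Proof. by []. Qed.
Lemma qscalM p p' : qscal (p * p') = qscal p * qscal p' - dotv (qvec p) (qvec p').
Proof. by []. Qed.
Lemma qvecM p p' : qvec (p * p') =
  qscal p *: qvec p' + qscal p' *: qvec p + crossv (qvec p) (qvec p').
Proof. by []. Qed.
Lemma qscal1 : qscal (1 : quat R) = 1. Proof. by []. Qed.
Lemma qvec1 : qvec (1 : quat R) = 0. Proof. by []. Qed.
Lemma qscal0 : qscal (0 : quat R) = 0. Proof. by []. Qed.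
Lemma qvec0 : qvec (0 : quat R) = 0. Proof. by []. Qed.
Lemma qscalQ t v : qscal (Quat t v) = t. Proof. by []. Qed.
Lemma qvecQ t v : qvec (Quat t v) = v. Proof. by []. Qed.
Lemma primalD h k : primal (h + k) = primal h + primal k. Proof. by []. Qed.
Lemma dualD h k : dual (h + k) = dual h + dual k. Proof. by []. Qed.
Lemma primalN h : primal (- h) = - primal h. Proof. by []. Qed.
Lemma dualN h : dual (- h) = - dual h. Proof. by []. Qed.
Lemma primalZ t h : primal (t *: h) = t *: primal h. Proof. by []. Qed.
Lemma dualZ t h : dual (t *: h) = t *: dual h. Proof. by []. Qed.
Lemma primalM h k : primal (h * k) = primal h * primal k. Proof. by []. Qed.
Lemma dualM h k : dual (h * k) = primal h * dual k + dual h * primal k. Proof. by []. Qed.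
Lemma primal1 : primal (1 : dquat R) = 1. Proof. by []. Qed.
Lemma dual1 : dual (1 : dquat R) = 0. Proof. by []. Qed.
Lemma primal0 : primal (0 : dquat R) = 0. Proof. by []. Qed.
Lemma dual0 : dual (0 : dquat R) = 0. Proof. by []. Qed.
Lemma primalQ p p' : primal (DQuat p p') = p. Proof. by []. Qed.
Lemma dualQ p p' : dual (DQuat p p') = p'. Proof. by []. Qed.

Definition componentE :=
  (primalD, dualD, primalN, dualN, primalZ, dualZ, primalM, dualM, primal1, dual1,
   primal0, dual0, primalQ, dualQ,
   (qscalD, qvecD, qscalN, qvecN, qscalZ, qvecZ, qscalM, qvecM, qscal1, qvec1,
   qscal0, qvec0, qscalQ, qvecQ)).

Lemma dquatP h k : primal h = primal k -> dual h = dual k -> h = k.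
Proof. by case: h k => [? ?] [? ?]; rewrite /primal /dual /= => -> ->. Qed.

Lemma quat_eq p p' : qscal p = qscal p' -> qvec p = qvec p' -> p = p'.
Proof. by move=> es ev; apply: quatP => // i; rewrite ev. Qed.

End Components.

Ltac quat_ring := apply: quat_eq; rewrite ?componentE; [scal_ring|vec_ring].
Ltac dquat_ring := apply: dquatP; quat_ring.

Section LineQuaternions.
Context {R : realType}.
Implicit Types (u q v r w s : 'rV[R]_3) (h : dquat R).

(** For [u] of norm 1 and orthogonal to [q], the half-turn about
    [plucker_line u q]. *)
Definition line_quat u q : dquat R := DQuat (Quat 0 u) (Quat 0 q).

Definition eps v : dquat R := DQuat 0 (Quat 0 v).

Lemma line_quat_sqr u q : dotv u u = 1 -> dotv u q = 0 ->
  line_quat u q * line_quat u q = -1.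
Proof.
move=> u1 uq; have e : line_quat u q * line_quat u q =
    DQuat (Quat (- dotv u u) 0) (Quat (- (2%:R * dotv u q)) 0) by dquat_ring.
by rewrite e u1 uq; dquat_ring.
Qed.

Lemma line_quatZ t u q : line_quat (t *: u) (t *: q) = t *: line_quat u q.
Proof. dquat_ring. Qed.

(** The half-turn about the axis of a rotation quaternion. *)
Definition unit_line h : dquat R :=
  let t := (normv (qvec (primal h)))^-1 in
  line_quat (t *: qvec (primal h)) (t *: qvec (dual h)).

Lemma rotation_quat_unit h : rotation_quat h -> exists u q,
  [/\ dotv u u = 1, dotv u q = 0, unit_line h = line_quat u q,
      axis h = plucker_line u q &
      exists s t : R, t != 0 /\ h = s%:A + t *: unit_line h].
Proof.
move=> rot; have [u0 s0 uq] := rotation_quatP rot.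
set u := qvec (primal h) in u0 uq *; set q := qvec (dual h) in uq *.
have n0 : normv u != 0 by rewrite lt0r_neq0 // sqrtr_gt0 dotv_gt0.
exists ((normv u)^-1 *: u), ((normv u)^-1 *: q); split=> //.
- rewrite dotvZl dotvZr -[dotv u u]sqr_sqrtr ?ltW ?dotv_gt0 // -/(normv u).
  by rewrite expr2 mulKf // mulVf.
- by rewrite dotvZl dotvZr uq !mulr0.
- by rewrite axisE // plucker_lineZ // invr_neq0.
- exists (qscal (primal h)), (normv u); split=> //.
  rewrite /unit_line -/u -/q line_quatZ scalerA divff // scale1r.
  apply: dquatP; apply: quat_eq; rewrite ?componentE ?s0 -/u -/q.
  + by rewrite mulr1 addr0.
  + by vec_ring.
  + by rewrite mulr0 addr0.
  + by vec_ring.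
Qed.

Lemma line_quat_indep u q v r :
  dotv v v = 1 -> plucker_line u q <> plucker_line v r ->
  forall c d : R, line_quat v r <> c%:A + d *: line_quat u q.
Proof.
move=> v1 ne c d e; apply: ne.
have ev : v = d *: u.
  have := congr1 (fun h => qvec (primal h)) e.
  by rewrite /line_quat !componentE scaler0 add0r.
have er : r = d *: q.
  have := congr1 (fun h => qvec (dual h)) e.
  by rewrite /line_quat !componentE scaler0 add0r.
have d0 : d != 0.
  by apply: contraTneq (unit_neq0 v1) => d0; rewrite ev d0 scale0r eqxx.
by rewrite ev er plucker_lineZ.
Qed.

Lemma pure_quat_indep u v : crossv u v != 0 ->
  forall c d : R, Quat 0 v <> c%:A + d *: Quat 0 u.
Proof.
move=> uv c d /(congr1 qvec); rewrite !componentE scaler0 add0r => e.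
by move: uv; rewrite e crossvZr crossvv scaler0 eqxx.
Qed.

Lemma pure_quat_sqr u : dotv u u = 1 -> (Quat 0 u : quat R) * Quat 0 u = -1.
Proof.
move=> u1; have e : (Quat 0 u : quat R) * Quat 0 u = Quat (- dotv u u) 0 by quat_ring.
by rewrite e u1; quat_ring.
Qed.

(** Multiplying by the conjugate of [k] multiplies [p] by the positive norm of
    [k]. *)
Lemma quat_mul_eq0 (p k : quat R) : p * k = 0 -> k != 0 -> p = 0.
Proof.
move=> pk k0; have e : p * k * qconj k = (qscal k ^+ 2 + dotv (qvec k) (qvec k)) *: p.
  by rewrite /qconj; quat_ring.
move: e; rewrite pk mul0r => /esym/eqP; rewrite scaler_eq0 => /orP[|/eqP//].
have [k1|k1] := eqVneq (qvec k) 0.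
  have [k2|k2] := eqVneq (qscal k) 0.
    by case/eqP: k0; apply: quat_eq; rewrite ?componentE.
  rewrite k1 (_ : dotv 0 0 = 0) ?addr0; last by scal_ring.
  by rewrite gt_eqF // exprn_even_gt0.
by rewrite gt_eqF // ltr_wpDl ?sqr_ge0 ?dotv_gt0.
Qed.

Lemma primal_comb (a b : dquat R) x0 x1 x2 x3 :
  primal (comb a b x0 x1 x2 x3) = comb (primal a) (primal b) x0 x1 x2 x3.
Proof. by []. Qed.

Lemma primal_comb_eq0 u q v r x0 x1 x2 x3 : dotv u u = 1 -> crossv u v != 0 ->
  primal (comb (line_quat u q) (line_quat v r) x0 x1 x2 x3) = 0 ->
  [/\ x0 = 0, x1 = 0, x2 = 0 & x3 = 0].
Proof.
move=> u1 uv; rewrite primal_comb.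
by apply: comb_eq0; [exact: pure_quat_sqr|exact: pure_quat_indep].
Qed.

(** Twice the dual scalar product of two lines is, up to sign, their
    anticommutator; its dual part is the reciprocal product. *)
Lemma line_quat_anticomm u q v r :
  line_quat v r * line_quat u q = (- 2%:R * dotv u v)%:A +
    (- 2%:R * reciprocal u q v r) *: DQuat 0 1 - line_quat u q * line_quat v r.
Proof. rewrite /reciprocal; dquat_ring. Qed.

(** In the polar form of the norm, [1], [a], [b], [a * b] have real products except
    for the pairs [(a, b)] and [(1, a * b)], which give [+/-] the dual scalar
    product of the two lines. *)
Lemma study_comb u q v r x0 x1 x2 x3 :
  dotv u q = 0 -> dotv v r = 0 ->
  dual (dqnorm (comb (line_quat u q) (line_quat v r) x0 x1 x2 x3)) =
    Quat (2%:R * (reciprocal u q v r * (x1 * x2 - x0 * x3))) 0.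
Proof.
move=> uq vr.
(* The extra terms in [dotv u q] and [dotv v r], both zero, complete the equation
   to a polynomial identity. *)
have -> : dual (dqnorm (comb (line_quat u q) (line_quat v r) x0 x1 x2 x3)) =
   Quat (2%:R * (reciprocal u q v r * (x1 * x2 - x0 * x3) + x1 ^+ 2 * dotv u q
      + x2 ^+ 2 * dotv v r +
      x3 ^+ 2 * (dotv u u * dotv v r + dotv v v * dotv u q))) 0.
  rewrite /dqnorm /dqconj /qconj /comb /reciprocal; quat_ring.
by rewrite uq vr !(mulr0, addr0).
Qed.

End LineQuaternions.

(** * Intertwining relations *)

(** The map [X |-> a * X * c] is an involution, because [a] and [c] square to [-1],
    and its eigenvectors are the elements that intertwine [a] with [c] or [- c]. As
    [a * X * c = - (a * B)], the projections of [X] to the two eigenspaces are, up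
    to the factor 2, [X + a * B] and [X - a * B]; they are not both zero. *)
Lemma intertwiner (R : realType) (A : algType R) (a c X B : A) :
  a * a = -1 -> c * c = -1 -> X = B * c -> X != 0 ->
  exists s : R, [/\ s * s = 1, X + s *: (a * B) != 0 &
    a * (X + s *: (a * B)) = s *: ((X + s *: (a * B)) * c)].
Proof.
move=> sqa sqc eX X0.
have Xc : X * c = - B by rewrite eX -mulrA sqc mulrN1.
have main s : s * s = 1 ->
    a * (X + s *: (a * B)) = s *: ((X + s *: (a * B)) * c).
  move=> ss; rewrite mulrDr mulrDl Xc -scalerAr -scalerAl mulrA sqa mulN1r.
  by rewrite -mulrA -eX scalerDr scalerA ss scale1r !scalerN addrC.
have [e1|n1] := eqVneq (X + 1 *: (a * B)) 0; last first.
  by exists 1; split=> //; [rewrite mulr1|apply: main; rewrite mulr1].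
exists (-1); split; rewrite ?mulrNN ?mulr1 //; last by apply: main; rewrite mulrNN mulr1.
apply: contra_neq X0 => e2; have : X + X = 0.
  by move: (congr2 +%R e1 e2); rewrite scaleN1r scale1r addrACA subrr !addr0.
rewrite -mulr2n -scaler_nat => /eqP; rewrite scaler_eq0 pnatr_eq0 /=.
by move/eqP.
Qed.

Section TraceRelations.
Variables (R : realType) (A : algType R) (a b c : A) (f : {linear A -> R^o}).
Variables (x0 x1 x2 x3 : R).
Hypotheses (sqa : a * a = -1) (sqb : b * b = -1) (sqc : c * c = -1).
Let m := comb a b x0 x1 x2 x3.
Hypothesis intertwines : a * m = m * c.
Variables (f1 P Q C D K : R).
Hypotheses (ft : f 1 = f1) (fa : f a = 0) (fb : f b = 0) (fc : f c = 0).
Hypotheses (fab : f (a * b) = - P) (fac : f (a * c) = - C).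
Hypotheses (fbc : f (b * c) = - Q) (fcb : f (c * b) = - Q).
Hypotheses (fabc : f (a * b * c) = - D) (facb : f (a * c * b) = D).
Hypotheses (fbcb : f (b * c * b) = 0) (fabcb : f (a * b * c * b) = - K).

(** Let [E = a * m - m * c] and [F = m + a * m * c]; both vanish. The two conclusions
    are [f (F * b + E) = 0] and [f (E * b - F) = 0], where [F * b + E] and
    [E * b - F] are the real and imaginary parts of
    [(a - i) * m * (c + i) * (b - i)] in the complexified algebra.
    The functional [f] stays abstract because the primal and the dual scalar part
    both occur, with different values on the words in [a], [b], [c]. *)
Lemma trace_relations :
  (x0 + x3) * D + x1 * (C - P + Q - f1) - x2 * (f1 + P - Q + K) = 0 /\
  (x2 - x1) * D + x0 * (C - P + Q - f1) + x3 * (f1 + P - Q + K) = 0.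
Proof.
have mulc y0 y1 y2 y3 : comb a b y0 y1 y2 y3 * c =
    y0 *: c + y1 *: (a * c) + y2 *: (b * c) + y3 *: (a * b * c).
  by rewrite /comb !mulrDl -!scalerAl mul1r.
have mulcb y0 y1 y2 y3 : comb a b y0 y1 y2 y3 * c * b =
    y0 *: (c * b) + y1 *: (a * c * b) + y2 *: (b * c * b) + y3 *: (a * b * c * b).
  by rewrite mulc !mulrDl -!scalerAl.
have ame : comb a b (- x1) x0 (- x3) x2 = m * c by rewrite -mull_comb.
have mce : comb a b (- x1) x0 (- x3) x2 * c = - m.
  by rewrite ame -mulrA sqc mulrN1.
have eE := congr1 f ame; have eF := congr1 f mce.
have eEb := congr1 (fun z => f (z * b)) ame.
have eFb := congr1 (fun z => f (z * b)) mce.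
move: eE eF eEb eFb; rewrite /= mulNr !mulcb !mulr_comb // !mulc.
rewrite /comb !linearN !linearD /= !linearZ /= ft fa fb fc fab fac fbc fcb fabc facb fbcb fabcb.
rewrite /GRing.scale /= => eE eF eEb eFb.
split; lra.
Qed.

End TraceRelations.

(** * Scalar parts of an intertwining relation *)

Section ScalarParts.
Context {R : realType}.
Implicit Types (u q v r w s : 'rV[R]_3) (h k : dquat R) (t : R).

Definition triple u v w : R := dotv u (crossv v w).

Definition scal0 h : R := qscal (primal h).
Definition scal1 h : R := qscal (dual h).

Lemma scal0D h k : scal0 (h + k) = scal0 h + scal0 k. Proof. by []. Qed.
Lemma scal0N h : scal0 (- h) = - scal0 h. Proof. by []. Qed.
Lemma scal0Z t h : scal0 (t *: h) = t * scal0 h. Proof. by []. Qed.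
Lemma scal1D h k : scal1 (h + k) = scal1 h + scal1 k. Proof. by []. Qed.
Lemma scal1N h : scal1 (- h) = - scal1 h. Proof. by []. Qed.
Lemma scal1Z t h : scal1 (t *: h) = t * scal1 h. Proof. by []. Qed.
Lemma scal0_1 : scal0 1 = 1. Proof. by []. Qed.
Lemma scal1_1 : scal1 1 = 0. Proof. by []. Qed.
Lemma scal0_line u q : scal0 (line_quat u q) = 0. Proof. by []. Qed.
Lemma scal1_line u q : scal1 (line_quat u q) = 0. Proof. by []. Qed.

Lemma scal0_line2 u q v r : scal0 (line_quat u q * line_quat v r) = - dotv u v.
Proof. by rewrite /scal0 /line_quat !componentE mul0r sub0r. Qed.

Lemma scal1_line2 u q v r :
  scal1 (line_quat u q * line_quat v r) = - reciprocal u q v r.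
Proof. by rewrite /scal1 /line_quat /reciprocal !componentE !mul0r !sub0r opprD. Qed.

Lemma scal0_line3 u q v r w s :
  scal0 (line_quat u q * line_quat v r * line_quat w s) = - triple u v w.
Proof. rewrite /scal0 /line_quat /triple !componentE; scal_ring. Qed.

Lemma scal1_line3 u q v r w s :
  scal1 (line_quat u q * line_quat v r * line_quat w s) =
  - (triple u v s + triple u r w + triple q v w).
Proof. rewrite /scal1 /line_quat /triple !componentE; scal_ring. Qed.

Definition epsilon : dquat R := DQuat 0 1.

Lemma epsilonC h : h * epsilon = epsilon * h.
Proof. by apply: dquatP; rewrite !componentE ?mulr0 ?mul0r // mul1r mulr1 addrC. Qed.

Lemma scal0_eps h : scal0 (epsilon * h) = 0.
Proof. by rewrite /scal0 !componentE mul0r (_ : dotv 0 _ = 0) ?subr0 //; scal_ring. Qed.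
Lemma scal1_eps h : scal1 (epsilon * h) = scal0 h.
Proof. rewrite /scal1 /scal0 !componentE; scal_ring. Qed.

Lemma scal0_is_linear : linear (scal0 : dquat R -> R^o). Proof. by []. Qed.
Lemma scal1_is_linear : linear (scal1 : dquat R -> R^o). Proof. by []. Qed.
HB.instance Definition _ := GRing.isLinear.Build R (dquat R) R^o *:%R scal0 scal0_is_linear.
HB.instance Definition _ := GRing.isLinear.Build R (dquat R) R^o *:%R scal1 scal1_is_linear.

Lemma line_quat_conj u q v r w s : dotv v v = 1 -> dotv v r = 0 ->
  line_quat v r * line_quat w s * line_quat v r =
  line_quat w s - 2%:R *: (dotv v w *: line_quat v r +
    reciprocal v r w s *: (epsilon * line_quat v r)).
Proof.
move=> v1 vr; have -> : line_quat v r * line_quat w s * line_quat v r =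
    (dotv v v) *: line_quat w s + (2%:R * dotv v r) *: (epsilon * line_quat w s)
   - 2%:R *: (dotv v w *: line_quat v r + reciprocal v r w s *: (epsilon * line_quat v r)).
  rewrite /line_quat /reciprocal; dquat_ring.
by rewrite v1 vr scale1r mulr0 scale0r addr0.
Qed.

End ScalarParts.

Section Relation.
Context {R : realType}.
Variables (u q v r w s : 'rV[R]_3).
Hypotheses (u1 : dotv u u = 1) (uq : dotv u q = 0).
Hypotheses (v1 : dotv v v = 1) (vr : dotv v r = 0).
Hypotheses (w1 : dotv w w = 1) (ws : dotv w s = 0).
Let a := line_quat u q.
Let b := line_quat v r.
Let c := line_quat w s.

Let P0 := dotv u v. Let P1 := reciprocal u q v r.
Let Q0 := dotv v w. Let Q1 := reciprocal v r w s.
Let C0 := dotv u w. Let C1 := reciprocal u q w s.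
Let D0 := triple u v w. Let D1 := triple u v s + triple u r w + triple q v w.
Variables (x0 x1 x2 x3 : R).
Hypothesis intertwines : a * comb a b x0 x1 x2 x3 = comb a b x0 x1 x2 x3 * c.

Let abcb : a * b * c * b =
  a * c - 2%:R *: (Q0 *: (a * b) + Q1 *: (epsilon * (a * b))).
Proof.
rewrite -mulrA -mulrA (mulrA b) line_quat_conj // mulrBr -scalerAr mulrDr -!scalerAr.
by rewrite !mulrA epsilonC.
Qed.

Let tripleE : triple u w v = - triple u v w.
Proof. by rewrite /triple; scal_ring. Qed.
Let rC : reciprocal w s v r = Q1.
Proof. by rewrite /Q1 /reciprocal; scal_ring. Qed.
Let tE : triple u w r + triple u s v + triple q w v = - D1.
Proof. by rewrite /D1 /triple; scal_ring. Qed.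

(** With [P], [Q], [C] the scalar products of the pairs (1,2), (2,3), (1,3) of lines,
    [D] their triple product, [V = C - P * Q] and [U = (1 + P) * (1 - Q)], all of
    them dual numbers, this lemma and the next one are the primal and the dual part
    of [(V + i D) * ((x0 + x3) - i (x2 - x1)) = U * ((x0 - x3) + i (x1 + x2))]. *)
Lemma primal_relation :
  (x0 + x3) * D0 - (x2 - x1) * (C0 - P0 * Q0) = (x1 + x2) * ((1 + P0) * (1 - Q0)) /\
  (x0 + x3) * (C0 - P0 * Q0) + (x2 - x1) * D0 = (x0 - x3) * ((1 + P0) * (1 - Q0)).
Proof.
have [] := @trace_relations _ _ a b c scal0 x0 x1 x2 x3 (line_quat_sqr u1 uq)
  (line_quat_sqr v1 vr) (line_quat_sqr w1 ws) intertwines 1 P0 Q0 C0 D0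
  (C0 - 2%:R * (Q0 * P0)).
- exact: scal0_1.
- exact: scal0_line.
- exact: scal0_line.
- exact: scal0_line.
- exact: scal0_line2.
- exact: scal0_line2.
- exact: scal0_line2.
- rewrite [LHS]scal0_line2; by rewrite dotvC.
- exact: scal0_line3.
- rewrite [LHS]scal0_line3; by rewrite tripleE opprK.
- rewrite [LHS]scal0_line3; by rewrite /triple; scal_ring.
- rewrite abcb [LHS]scal0D scal0N scal0Z scal0D scal0Z scal0Z scal0_eps
     /a /b /c !scal0_line2 -/P0 -/C0.
  by ring.
move=> e1 e2; split; lra.
Qed.

Lemma dual_relation :
  (x0 + x3) * D1 - (x2 - x1) * (C1 - P0 * Q1 - P1 * Q0) =
     (x1 + x2) * (P1 * (1 - Q0) - (1 + P0) * Q1) /\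
  (x0 + x3) * (C1 - P0 * Q1 - P1 * Q0) + (x2 - x1) * D1 =
     (x0 - x3) * (P1 * (1 - Q0) - (1 + P0) * Q1).
Proof.
have [] := @trace_relations _ _ a b c scal1 x0 x1 x2 x3 (line_quat_sqr u1 uq)
  (line_quat_sqr v1 vr) (line_quat_sqr w1 ws) intertwines 0 P1 Q1 C1 D1
  (C1 - 2%:R * (Q0 * P1 + Q1 * P0)).
- exact: scal1_1.
- exact: scal1_line.
- exact: scal1_line.
- exact: scal1_line.
- exact: scal1_line2.
- exact: scal1_line2.
- exact: scal1_line2.
- rewrite [LHS]scal1_line2; by rewrite rC.
- exact: scal1_line3.
- rewrite [LHS]scal1_line3; by rewrite tE opprK.
- rewrite [LHS]scal1_line3; by rewrite /triple; scal_ring.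
- rewrite abcb [LHS]scal1D scal1N scal1Z scal1D scal1Z scal1Z scal1_eps
     /a /b /c !scal1_line2 scal0_line2.
  rewrite -/P0 -/P1 -/C1; by ring.
move=> e1 e2; split; lra.
Qed.

End Relation.

(** * The Bennett conditions *)

Lemma sum_sqr_eq0 (R : realFieldType) (x y : R) : x ^+ 2 + y ^+ 2 = 0 -> x = 0 /\ y = 0.
Proof.
by move=> /eqP; rewrite paddr_eq0 ?sqr_ge0 // !sqrf_eq0 => /andP[/eqP-> /eqP->].
Qed.

(** The matrix [[D, -V; V, D]] is a similarity, that is multiplication by a nonzero
    complex number. *)
Lemma similarity_eq0 (R : realFieldType) (g t V D : R) :
  V ^+ 2 + D ^+ 2 != 0 -> g * D - t * V = 0 -> g * V + t * D = 0 -> g = 0 /\ t = 0.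
Proof.
move=> n0 e1 e2; apply: sum_sqr_eq0; apply: (mulIf n0); rewrite mul0r.
transitivity ((g * D - t * V) ^+ 2 + (g * V + t * D) ^+ 2); first by ring.
by rewrite e1 e2; ring.
Qed.

(** In complex notation the first two equations say that the quotient of [V + i D]
    by [U] is [(d + i p) / (g - i t)]. The last two are obtained from them by a
    derivation fixing [g], [t], [p], [d] that multiplies [V + i D] by [k + i z] and
    [U] by [l]. As the quotient is constant, [k + i z = l]; and [k - l = x - y].

    Geometrically, let two lines make dual angles with cosines [P = cos A] and
    [Q = cos B] with a middle line, and let their normals enclose the dual angle [f]
    about it. For [U = (1 + P) * (1 - Q)] and [V + i D = sin A * sin B * exp (i f)],
    the quotient is [tan (A / 2) * cot (B / 2) * exp (i f)]. Its being an ordinary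
    complex number without dual part gives both the equal ratios of distance and
    sine and the coincidence of the feet. *)
Lemma half_tangent_rigidity (R : realFieldType) (x y z g t p d P Q V D U : R) :
  U != 0 -> V ^+ 2 + D ^+ 2 != 0 ->
  ~ [/\ g = 0, t = 0, p = 0 & d = 0] ->
  g * D - t * V = p * U -> g * V + t * D = d * U ->
  let k := x * P + y * Q in
  let l := - x * (1 - P) + y * (1 + Q) in
  g * (k * D + z * V) - t * (k * V - z * D) = p * (l * U) ->
  g * (k * V - z * D) + t * (k * D + z * V) = d * (l * U) ->
  x = y /\ z = 0.
Proof.
move=> U0 N0 n0 e1 e2 k l f1 f2.
have g1 : p * (x - y) + d * z = 0.
  apply: (mulIf U0); rewrite mul0r.
  transitivity (k * (p * U) + z * (d * U) - p * (l * U)); first by rewrite /k /l; ring.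
  by rewrite -f1 -e1 -e2; ring.
have g2 : d * (x - y) - p * z = 0.
  apply: (mulIf U0); rewrite mul0r.
  transitivity (k * (d * U) - z * (p * U) - d * (l * U)); first by rewrite /k /l; ring.
  by rewrite -f2 -e1 -e2; ring.
have [pd|pd] := eqVneq (p ^+ 2 + d ^+ 2) 0.
  have [p0 d0] := sum_sqr_eq0 pd; exfalso; apply: n0.
  rewrite p0 d0 !mul0r in e1 e2.
  by have [-> ->] := similarity_eq0 N0 e1 e2.
have [] : x - y = 0 /\ z = 0.
  apply: (similarity_eq0 (V := d) (D := - p)); first by rewrite sqrrN addrC.
    rewrite -[RHS]oppr0 -g1; ring.
  by rewrite -g2; ring.
by move=> /eqP; rewrite subr_eq0 => /eqP -> ->.
Qed.

Section Bennett.
Context {R : realType}.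
Implicit Types (u q v r w s F : 'rV[R]_3).

(** In adapted coordinates for the pairs (1,2) and (3,2), with feet [F] and
    [F + z *: v] on the middle line, the dual parts of all scalar and triple
    products are expressed by [x], [y], [z] and the primal parts alone; they turn
    [primal_relation] and [dual_relation] into the hypotheses of
    [half_tangent_rigidity]. *)
Lemma bennett_core u v w F (x y z x0 x1 x2 x3 : R) :
  dotv u u = 1 -> dotv v v = 1 -> dotv w w = 1 ->
  crossv u v != 0 -> crossv w v != 0 ->
  ~ [/\ x0 = 0, x1 = 0, x2 = 0 & x3 = 0] ->
  let a := line_quat u (crossv u (F + x *: crossv u v)) in
  let b := line_quat v (crossv v F) in
  let c := line_quat w (crossv w (F + z *: v + y *: crossv w v)) in
  a * comb a b x0 x1 x2 x3 = comb a b x0 x1 x2 x3 * c ->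
  x = y /\ z = 0.
Proof.
move=> u1 v1 w1 uv wv n0 a b c rel.
have orth (k1 k2 : 'rV[R]_3) : dotv k1 (crossv k1 k2) = 0 by scal_ring.
have [p1 p2] := primal_relation u1 (orth _ _) v1 (orth _ _) w1 (orth _ _) rel.
have [d1 d2] := dual_relation u1 (orth _ _) v1 (orth _ _) w1 (orth _ _) rel.
move: p1 p2 d1 d2.
have nuv : dotv (crossv u v) (crossv u v) = 1 - dotv u v ^+ 2.
  by rewrite dotv_crossv u1 v1 mulr1.
have nwv : dotv (crossv w v) (crossv w v) = 1 - dotv v w ^+ 2.
  by rewrite dotv_crossv v1 w1 mulr1 (dotvC w).
have eP : reciprocal u (crossv u (F + x *: crossv u v)) v (crossv v F) =
    - x * (1 - dotv u v ^+ 2) by rewrite reciprocal_feet nuv.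
have eQ : reciprocal v (crossv v F) w (crossv w (F + z *: v + y *: crossv w v)) =
    - y * (1 - dotv v w ^+ 2) by rewrite -nwv /reciprocal; scal_ring.
have eC : reciprocal u (crossv u (F + x *: crossv u v)) w
    (crossv w (F + z *: v + y *: crossv w v)) =
    - z * triple u v w + y * (dotv u w * dotv v w - dotv u v)
    + x * (dotv u w * dotv u v - dotv v w).
  (* Squared norms are inserted so that the identity becomes homogeneous, hence
     polynomial in the coordinates. *)
  rewrite -[X in y * (_ - X)]mulr1 -[X in x * (_ - X)]mulr1 -[in X in y * X]w1 -[in X in x * X]u1.
  rewrite /reciprocal /triple; scal_ring.
have eD : triple u v (crossv w (F + z *: v + y *: crossv w v)) +
    triple u (crossv v F) w + triple (crossv u (F + x *: crossv u v)) v w =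
    (x * dotv u v + y * dotv v w) * triple u v w +
    z * (dotv u w - dotv u v * dotv v w).
  rewrite -[X in z * (X - _)]mulr1 -v1 /triple; scal_ring.
have eN : (dotv u w - dotv u v * dotv v w) ^+ 2 + triple u v w ^+ 2 =
    dotv (crossv u v) (crossv u v) * dotv (crossv w v) (crossv w v).
  transitivity ((dotv u w * dotv v v - dotv u v * dotv v w) ^+ 2 +
     triple u v w ^+ 2 * dotv v v); first by rewrite v1 !mulr1.
  rewrite /triple; scal_ring.
rewrite eP eQ eC eD {eP eQ eC eD}.
set P := dotv u v in nuv eN *; set Q := dotv v w in nwv eN *.
set C := dotv u w in eN *; set D := triple u v w in eN *.
move=> p1 p2 d1 d2.
have N0 : (C - P * Q) ^+ 2 + D ^+ 2 != 0.
  by rewrite eN mulf_neq0 // lt0r_neq0 // dotv_gt0.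
have U0 : (1 + P) * (1 - Q) != 0.
  apply: mulf_neq0.
    apply: contraTneq (dotv_gt0 uv) => h; rewrite nuv.
    have -> : 1 - P ^+ 2 = (1 + P) * (1 - P) by ring.
    by rewrite h mul0r ltxx.
  apply: contraTneq (dotv_gt0 wv) => h; rewrite nwv.
  have -> : 1 - Q ^+ 2 = (1 - Q) * (1 + Q) by ring.
  by rewrite h mul0r ltxx.
apply: (half_tangent_rigidity (g := x0 + x3) (t := x2 - x1) (p := x1 + x2)
  (d := x0 - x3) (P := P) (Q := Q) (x := x) (y := y) (z := z) U0 N0 _ p1 p2).
- move=> [h1 h2 h3 h4]; apply: n0; split; lra.
- transitivity ((x0 + x3) * ((x * P + y * Q) * D + z * (C - P * Q)) - (x2 - x1) *
     (- z * D + y * (C * Q - P) + x * (C * P - Q) -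
      P * (- y * (1 - Q ^+ 2)) - - x * (1 - P ^+ 2) * Q)); first by ring.
  by rewrite d1; ring.
- transitivity ((x0 + x3) * (- z * D + y * (C * Q - P) + x * (C * P - Q) -
      P * (- y * (1 - Q ^+ 2)) - - x * (1 - P ^+ 2) * Q) +
      (x2 - x1) * ((x * P + y * Q) * D + z * (C - P * Q))); first by ring.
  by rewrite d2; ring.
Qed.

(** If the last two lines are parallel, [c = t * b + eps y] with [y] the displacement
    between them. Comparing [a * m] with [m * c], the primal parts of [1], [a], [b]
    and [a * b] being independent, forces [m * eps y = 0], so that [y = 0] since [m]
    has a nonzero primal part. *)
Lemma intertwiner_parallel23 u q v r w s x0 x1 x2 x3 :
  dotv u u = 1 -> dotv u q = 0 -> dotv v v = 1 -> dotv v r = 0 ->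
  dotv w w = 1 -> dotv w s = 0 ->
  crossv u v != 0 -> crossv v w = 0 ->
  ~ [/\ x0 = 0, x1 = 0, x2 = 0 & x3 = 0] ->
  let a := line_quat u q in let b := line_quat v r in
  a * comb a b x0 x1 x2 x3 = comb a b x0 x1 x2 x3 * line_quat w s ->
  plucker_line v r = plucker_line w s.
Proof.
move=> u1 uq v1 vr w1 ws uv vw n0 a b rel.
have [t t0 ew] := collinear (unit_neq0 v1) (unit_neq0 w1) vw.
pose y := s - t *: r.
have ec : line_quat w s = t *: b + eps y.
  by rewrite ew /b /line_quat /eps /y; dquat_ring.
have e0 : comb a b (- x1) x0 (- x3) x2 - t *: comb a b (- x2) (- x3) x0 x1 =
    comb a b x0 x1 x2 x3 * eps y.
  rewrite -mull_comb ?line_quat_sqr // rel ec mulrDr -scalerAr mulr_comb ?line_quat_sqr //.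
  by rewrite addrC addKr.
have pe : primal (eps y) = 0 by [].
have [] := @primal_comb_eq0 _ u q v r (- x1 - t * - x2) (x0 - t * - x3)
   (- x3 - t * x0) (x2 - t * x1) u1 uv.
  by rewrite -combZD e0 primalM pe mulr0.
move=> h1 h2 h3 h4.
have [y0|y0] := eqVneq y 0.
  have -> : s = t *: r by apply/eqP; rewrite -subr_eq0 -/y y0.
  by rewrite ew plucker_lineZ.
exfalso; apply: n0.
apply: (@primal_comb_eq0 _ u q v r) => //.
apply: (@quat_mul_eq0 _ _ (Quat 0 y)); last first.
  by apply: contra_neq y0 => /(congr1 qvec).
have := congr1 dual e0.
rewrite combZD h1 h2 h3 h4 dualM pe mulr0 addr0 => <-.
by rewrite /comb !scale0r !addr0.
Qed.

(** If the first two lines are parallel, [b = t * a + eps y] with [y] orthogonal to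
    [u], and [m = alpha + beta * eps y] with [alpha], [beta] in [R[a]]. The primal
    parts of [alpha] and [beta] commute with [u], while [y] anticommutes with it:
    cancelling [alpha], or [beta] if [alpha = 0], gives [w = u] or [w = - u]. *)
Lemma intertwiner_parallel12 u q v r w s x0 x1 x2 x3 :
  dotv u u = 1 -> dotv u q = 0 -> dotv v v = 1 -> dotv v r = 0 ->
  dotv w w = 1 -> crossv u v = 0 ->
  plucker_line u q <> plucker_line v r ->
  ~ [/\ x0 = 0, x1 = 0, x2 = 0 & x3 = 0] ->
  let a := line_quat u q in let b := line_quat v r in
  a * comb a b x0 x1 x2 x3 = comb a b x0 x1 x2 x3 * line_quat w s ->
  crossv u w = 0.
Proof.
move=> u1 uq v1 vr w1 uv neq n0 a b rel.
have u0 := unit_neq0 u1.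
have [t t0 ev] := collinear u0 (unit_neq0 v1) uv.
pose y := r - t *: q.
have y0 : y != 0.
  apply/eqP => y0; apply: neq.
  have -> : r = t *: q by apply/eqP; rewrite -subr_eq0 -/y y0.
  by rewrite ev plucker_lineZ.
have uy : dotv u y = 0.
  have : dotv v r = 0 by [].
  rewrite ev dotvZl => /eqP; rewrite mulf_eq0 (negPf t0) /= => /eqP ur.
  by transitivity (dotv u r - t * dotv u q); [rewrite /y; scal_ring|rewrite ur uq mulr0 subr0].
have eb : b = t *: a + eps y by rewrite /a /b /line_quat /eps /y ev; dquat_ring.
pose al := (x0 - x3 * t)%:A + (x1 + x2 * t) *: a.
pose be := x2%:A + x3 *: a.
have em : comb a b x0 x1 x2 x3 = al + be * eps y.
  rewrite combE eb -/be mulrDr addrA; congr (_ + _).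
  rewrite /be -scalerAr mulrDl -scalerAl -scalerAl mul1r line_quat_sqr // scalerDr.
  by rewrite /al !scalerDl scaleNr scalerN scalerN !scalerA
    (mulrC x3) (mulrC x2) [LHS](AC (2*2) (1*4*(2*3))).
have pu : primal a = Quat 0 u by [].
have pal : primal al = Quat (x0 - x3 * t) ((x1 + x2 * t) *: u).
  by rewrite /al /a /line_quat; quat_ring.
have pbe : primal be = Quat x2 (x3 *: u).
  by rewrite /be /a /line_quat; quat_ring.
have al_u : Quat 0 u * primal al = primal al * Quat 0 u by rewrite pal; quat_ring.
have be_u : Quat 0 u * primal be = primal be * Quat 0 u by rewrite pbe; quat_ring.
have quat0 (i j : R) : Quat i (j *: u) = 0 -> i = 0 /\ j = 0.
  move=> e; split; first exact: (congr1 qscal e).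
  by move/eqP: (congr1 qvec e); rewrite /= scaler_eq0 (negPf u0) orbF => /eqP.
have quat_cancel (p k1 k2 : quat R) : p != 0 -> p * k1 = p * k2 -> k1 = k2.
  move=> p0 /eqP; rewrite -subr_eq0 -mulrBr => /eqP pk; apply/eqP.
  rewrite -subr_eq0; apply/negPn/negP => k0; case/eqP: p0.
  exact: quat_mul_eq0 pk k0.
have Pm : primal (al + be * eps y) = primal al by rewrite primalD primalM mulr0 addr0.
have relp := congr1 primal rel.
rewrite em !primalM !Pm pu al_u in relp.
have [al0|al0] := eqVneq (primal al) 0; last first.
  have /(congr1 qvec) /= -> := quat_cancel _ _ _ al0 relp; exact: crossvv.
have al00 : al = 0.
  by move: al0; rewrite pal => /quat0[i0 j0]; rewrite /al i0 j0 !scale0r addr0.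
have be0 : primal be != 0.
  apply/eqP; rewrite pbe => /quat0[i0 j0]; apply: n0.
  move: al0; rewrite pal => /quat0[k0 l0]; rewrite i0 j0 in k0 l0 *.
  by split=> //; lra.
have Db : dual (be * eps y) = primal be * Quat 0 y by rewrite dualM mulr0 addr0.
have Pb : primal (be * eps y) = 0 by rewrite primalM mulr0.
have reld := congr1 dual rel.
rewrite em al00 add0r !(dualM _ (be * eps y)) (dualM (be * eps y))
  Pb Db mulr0 addr0 mul0r add0r in reld.
have pw : primal (line_quat w s) = Quat 0 w by [].
rewrite pu pw mulrA be_u -!mulrA in reld.
have /(congr1 qvec) e := quat_cancel _ _ _ be0 reld.
have yuw : crossv y (u + w) = 0.
  transitivity (qvec (Quat 0 y * Quat 0 w) - qvec (Quat 0 u * Quat 0 y)).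
    by rewrite !componentE; vec_ring.
  by rewrite e subrr.
have /(congr1 qscal) e' := quat_cancel _ _ _ be0 reld.
have yw : dotv y (u + w) = 0.
  transitivity (dotv u y + dotv y w); first by scal_ring.
  have : dotv y w = dotv u y.
    by move: e'; rewrite !componentE !mul0r !sub0r => /oppr_inj ->.
  by rewrite uy => ->; rewrite addr0.
have := crossv_eq0 y0 yuw; rewrite yw mul0r scale0r => /eqP.
rewrite addrC addr_eq0 => /eqP ->; by vec_ring.
Qed.

End Bennett.

(** * Triples of lines *)

Section Triples.
Context {R : realType}.
Implicit Types (u q v r w s : 'rV[R]_3).

(** For parallel half-turns [a] and [b] about distinct axes, [b - t *: a = eps y] for
    a sign [t] and some nonzero [y] orthogonal to the common direction [u]. The
    span of [1], [a], [b], [a * b] contains [eps y] and [eps (crossv u y)], hence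
    [eps y'] for all [y'] orthogonal to [u], in particular for the displacement of
    the third axis. *)
Lemma parallel_in_span u q v r w s :
  dotv u u = 1 -> dotv u q = 0 -> dotv v v = 1 -> dotv v r = 0 ->
  dotv w w = 1 -> dotv w s = 0 -> crossv u v = 0 -> crossv u w = 0 ->
  plucker_line u q <> plucker_line v r ->
  line_quat w s \in binary_span (line_quat u q) (line_quat v r).
Proof.
move=> u1 uq v1 vr w1 ws uv uw neq.
have u0 := unit_neq0 u1.
have par x y : dotv x x = 1 -> dotv x y = 0 -> crossv u x = 0 ->
    exists t, t != 0 /\ x = t *: u /\ dotv u y = 0.
  move=> x1 xy /(collinear u0 (unit_neq0 x1))[t t0 e]; exists t; do !split=> //.
  by move/eqP: xy; rewrite e dotvZl mulf_eq0 (negPf t0) => /eqP.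
have [t [t0 [ev ur]]] := par v r v1 vr uv.
have [k [k0 [ew us]]] := par w s w1 ws uw.
pose y := r - t *: q; pose y' := s - k *: q.
have y0 : y != 0.
  apply/eqP => y0; apply: neq.
  have -> : r = t *: q by apply/eqP; rewrite -subr_eq0 -/y y0.
  by rewrite ev plucker_lineZ.
have uy : dotv u y = 0.
  by transitivity (dotv u r - t * dotv u q); [rewrite /y; scal_ring|rewrite ur uq mulr0 subr0].
have uy' : dotv u y' = 0.
  by transitivity (dotv u s - k * dotv u q); [rewrite /y'; scal_ring|rewrite us uq mulr0 subr0].
have yy : dotv y y != 0 by rewrite lt0r_neq0 // dotv_gt0.
pose l := dotv y' y / dotv y y; pose m := dotv y' (crossv u y) / dotv y y.
have ey' : y' = l *: y + m *: crossv u y.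
  clear -u1 uy uy' yy; clearbody y y'.
  apply: (scalerI yy); rewrite [RHS]scalerDr !scalerA /l /m !(mulrC (dotv y y)) !divfK //.
  (* The Gram expansion of [y'] with all its terms; those with a factor [dotv u y]
     or [dotv u y'] vanish. *)
  have : dotv u u *: (dotv y y *: y') = dotv u u *: (dotv y' y *: y) +
      dotv y' (crossv u y) *: crossv u y + (dotv y y * dotv u y') *: u +
      dotv u y *: (dotv u y *: y') - (dotv u y * dotv y y') *: u -
      (dotv u y * dotv u y') *: y.
    by vec_ring.
  by rewrite u1 uy uy' !(mulr0, mul0r, scale0r, addr0, subr0, scale1r).
apply/binary_spanP; exists (m * t), (k - l * t), l, m.
have es : s = k *: q + (l *: y + m *: crossv u y) by rewrite -ey' /y' subrKC.
have aby : line_quat u q * line_quat v r = (- t)%:A + eps (crossv u y).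
  have -> : line_quat u q * line_quat v r = DQuat (Quat (- (t * dotv u u)) 0)
      (Quat (- (dotv u r + t * dotv u q)) (crossv u y)).
    by rewrite ev /y /line_quat; dquat_ring.
  by rewrite u1 ur uq /eps; dquat_ring.
rewrite /comb aby ew es ev /y /line_quat /eps; dquat_ring.
Qed.

Lemma parallel_reciprocal u q v r :
  u != 0 -> v != 0 -> dotv u q = 0 -> dotv v r = 0 -> crossv u v = 0 ->
  reciprocal u q v r = 0.
Proof.
move=> u0 v0 uq vr /(collinear u0 v0)[t t0 e].
move/eqP: vr; rewrite e dotvZl mulf_eq0 (negPf t0) => /eqP ur.
by rewrite /reciprocal ur dotvZr dotvC uq mulr0 addr0.
Qed.

Lemma line_quat_anticomm0 u q v r : reciprocal u q v r = 0 ->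
  line_quat v r * line_quat u q = (- 2%:R * dotv u v)%:A - line_quat u q * line_quat v r.
Proof. by move=> e; rewrite line_quat_anticomm e mulr0 scale0r addr0. Qed.

Lemma study_span u q v r : dotv u q = 0 -> dotv v r = 0 ->
  dotv u u = 1 -> dotv v v = 1 ->
  plucker_line u q <> plucker_line v r ->
  (forall x, x \in binary_span (line_quat u q) (line_quat v r) -> x != 0 -> study x)
  <-> reciprocal u q v r = 0.
Proof.
move=> uq vr u1 v1 neq; split=> [st|rec0 x /binary_spanP[x0 [x1 [x2 [x3 ->]]]] _]; last first.
  rewrite /study study_comb // rec0 mul0r mulr0; exact: quat_eq.
set a := line_quat u q in st *; set b := line_quat v r in st *.
have inL : comb a b 0 1 1 0 \in binary_span a b.
  by apply/binary_spanP; exists 0, 1, 1, 0.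
have n0 : comb a b 0 1 1 0 != 0.
  apply/eqP => e; have := comb_eq0 (line_quat_sqr u1 uq) (line_quat_indep v1 neq) e.
  by case=> _ /eqP; rewrite oner_eq0.
have := st _ inL n0.
rewrite /study study_comb // => /(congr1 qscal)/eqP.
by rewrite qscalQ qscal0 mulr1 mulr0 subr0 mulr1 mulf_eq0 pnatr_eq0 => /eqP.
Qed.

(** If the span [L] of [1], [a], [b], [a * b] is stable under right multiplication
    by [c], it also is the span of [1], [b], [c], [b * c], hence contains [b * a] and
    the anticommutator of [a] and [b]. If the dual part of the latter were nonzero,
    [L] would contain the dual unit, and the first two axes would not be parallel;
    but for such axes the primal part is injective on [L]. So the first two axes are
    concurrent, and [c] in [L] makes the third one concurrent with them. *)
Lemma four_dim_concurrent u q v r w s :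
  let a := line_quat u q in let b := line_quat v r in let c := line_quat w s in
  dotv u q = 0 -> dotv v r = 0 -> dotv w s = 0 ->
  dotv u u = 1 -> dotv v v = 1 -> dotv w w = 1 ->
  plucker_line u q <> plucker_line v r -> plucker_line v r <> plucker_line w s ->
  (rmul c @: binary_span a b <= binary_span a b)%VS ->
  concurrent [set plucker_line u q; plucker_line v r; plucker_line w s].
Proof.
move=> a b c uq vr ws u1 v1 w1 nuv nvw /subvP stab.
have sqa := line_quat_sqr u1 uq; have sqb := line_quat_sqr v1 vr.
set L := binary_span a b in stab.
have [L1 [La [Lb Lab]]] : 1 \in L /\ a \in L /\ b \in L /\ a * b \in L.
  by rewrite !memv_span // !inE eqxx ?orbT.
have stabc x : x \in L -> x * c \in L.
  by move=> Lx; rewrite -rmulE; apply: stab; apply: memv_img.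
have Lc : c \in L by rewrite -[c]mul1r stabc.
have Lbc : b * c \in L by rewrite stabc.
have LL : binary_span b c = L.
  apply/eqP; rewrite eqEdim; apply/andP; split.
    by apply/span_subvP => x; rewrite !inE => /or4P[] /eqP ->.
  by rewrite !dim_binary_span //; apply: line_quat_indep.
have Lba : b * a \in L.
  by rewrite -LL mull_binary_span // LL.
have rec0 : reciprocal u q v r = 0.
  have [//|rec0] := eqVneq (reciprocal u q v r) 0.
  have uv : crossv u v != 0.
    apply: contra_neq rec0; apply: parallel_reciprocal => //; exact: unit_neq0.
  have : (- 2%:R * reciprocal u q v r) *: DQuat 0 1 \in L.
    have -> : (- 2%:R * reciprocal u q v r) *: DQuat 0 1 =
       b * a - (- 2%:R * dotv u v)%:A + a * b.
      by rewrite line_quat_anticomm -/a -/b addrAC subrK addrAC subrr add0r.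
    by rewrite !(memvD, memvN, memvZ).
  case/binary_spanP=> x0 [x1 [x2 [x3 e]]].
  have [] := @primal_comb_eq0 _ u q v r x0 x1 x2 x3 u1 uv.
    by rewrite -e primalZ scaler0.
  move=> h0 h1 h2 h3; have /eqP := congr1 (fun z => qscal (dual z)) e.
  rewrite h0 h1 h2 h3 /comb !scale0r !addr0 dualZ qscalZ mulr1.
  by rewrite mulf_eq0 oppr_eq0 pnatr_eq0 (negPf rec0).
case/binary_spanP: Lc => x0 [x1 [x2 [x3 e]]].
apply: (concurrent3 (x := x1) (y := x2) (z := x3)) => //; try exact: unit_neq0.
  have := congr1 (fun z => qvec (primal z)) e.
  rewrite /c /a /b /line_quat /comb !componentE => ->; vec_ring.
have := congr1 (fun z => qvec (dual z)) e.
rewrite /c /a /b /line_quat /comb !componentE => ->; vec_ring.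
Qed.

(** Let [L] be the span of [1], [a], [b], [a * b]. By dimension, [L] and [L * c] have
    a nonzero element in common, which gives an intertwining [m] in [L]. If the first
    two axes were parallel, [m] would force all three to be, and then [L * c] would
    be contained in [L]; if only the last two were parallel, [m] would force them to
    coincide. Otherwise [bennett_core] applies. *)
Lemma six_dim_bennett u q v r w s :
  let a := line_quat u q in let b := line_quat v r in let c := line_quat w s in
  dotv u q = 0 -> dotv v r = 0 -> dotv w s = 0 ->
  dotv u u = 1 -> dotv v v = 1 -> dotv w w = 1 ->
  plucker_line u q <> plucker_line v r -> plucker_line v r <> plucker_line w s ->
  \dim (binary_span a b + rmul c @: binary_span a b) = 6%N ->
  bennett_conditions (plucker_line u q) (plucker_line v r) (plucker_line w s).
Proof.
move=> a b c uq vr ws u1 v1 w1 nuv nvw dim6.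
have sqa := line_quat_sqr u1 uq; have sqb := line_quat_sqr v1 vr.
have sqc := line_quat_sqr w1 ws.
have dim4 : \dim (binary_span a b) = 4%N.
  by apply: dim_binary_span => //; apply: line_quat_indep.
have uw_par : crossv u v = 0 -> crossv u w <> 0.
  move=> uv uw; have := parallel_in_span u1 uq v1 vr w1 ws uv uw nuv.
  move=> cL; have /addv_idPl e : (rmul c @: binary_span a b <= binary_span a b)%VS.
    apply/subvP => _ /memv_imgP[x Lx ->]; rewrite rmulE.
    apply: (mul_binary_span sqa sqb _ Lx cL).
    apply: line_quat_anticomm0; apply: parallel_reciprocal => //; exact: unit_neq0.
  by move: dim6; rewrite e dim4.
have dimc : \dim (rmul c @: binary_span a b) = 4%N.
  rewrite limg_dim_eq //; apply/eqP; rewrite -subv0; apply/subvP => x.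
  rewrite memv_cap memv_ker rmulE memv0 => /andP[_ /eqP xc].
  by rewrite -[x]mulr1 -[1]opprK -sqc mulrN mulrA xc mul0r oppr0.
have [X] : exists X, X \in (binary_span a b :&: rmul c @: binary_span a b)%VS /\ X != 0.
  exists (vpick (binary_span a b :&: rmul c @: binary_span a b)%VS).
  rewrite memv_pick vpick0 -dimv_eq0; split=> //.
  have := dimv_sum_cap (binary_span a b) (rmul c @: binary_span a b).
  by rewrite dim6 dim4 dimc => /eqP; rewrite (eqn_add2l 6 _ 2) => /eqP ->.
case; rewrite memv_cap => /andP[/binary_spanP[x0 [x1 [x2 [x3 eX]]]] /memv_imgP[B]].
case/binary_spanP=> b0 [b1 [b2 [b3 eB]]]; rewrite rmulE => eXB X0.
have [t [tt]] := intertwiner sqa sqc eXB X0.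
have -> : X + t *: (a * B) = comb a b (x0 - - t * - b1) (x1 - - t * b0)
    (x2 - - t * - b3) (x3 - - t * b2).
  by rewrite -combZD -mull_comb // -eB -eX scaleNr opprK.
set y0 := x0 - _; set y1 := x1 - _; set y2 := x2 - _; set y3 := x3 - _.
move=> M0 rel.
have n0 : ~ [/\ y0 = 0, y1 = 0, y2 = 0 & y3 = 0].
  case=> e0 e1 e2 e3; move: M0.
  by rewrite e0 e1 e2 e3 /comb !scale0r !addr0 eqxx.
(* The sign [t] is absorbed into the orientation of the third line. *)
have t0 : t != 0 by apply: contra_eq_neq tt => ->; rewrite mul0r eq_sym oner_eq0.
rewrite scalerAr -line_quatZ in rel.
rewrite -(plucker_lineZ w s t0) in nvw *.
have tws : dotv (t *: w) (t *: s) = 0 by rewrite dotvZl dotvZr ws !mulr0.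
have tw1 : dotv (t *: w) (t *: w) = 1 by rewrite dotvZl dotvZr w1 mulr1.
have uw_par' : crossv u v = 0 -> crossv u (t *: w) <> 0.
  by move=> uv; rewrite crossvZr => /eqP; rewrite scaler_eq0 (negPf t0) => /eqP; exact: uw_par.
move: {uw_par dim6 dimc eXB sqc ws w1 c} (t *: w) (t *: s) nvw rel tws tw1 uw_par'.
move=> w' s' nvw rel ws w1 uw.
have uv : crossv u v != 0.
  apply/eqP => uv; apply: (uw uv).
  exact: (intertwiner_parallel12 u1 uq v1 vr w1 uv nuv n0 rel).
have vw : crossv w' v != 0.
  apply/eqP => wv; apply: nvw.
  apply: (intertwiner_parallel23 u1 uq v1 vr w1 ws uv _ n0 rel).
  by transitivity (- crossv w' v); [vec_ring|rewrite wv oppr0].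
have [u0 [v0 w0]] := (unit_neq0 u1, (unit_neq0 v1, unit_neq0 w1)).
have [F [x [eq er]]] := normal_feet uv u0 v0 uq vr.
have [G [y [es er']]] := normal_feet vw w0 v0 ws vr.
have [z eG] : exists z, G = F + z *: v.
  have [z e] : exists z, G - F = z *: v.
    exists (dotv v (G - F) / dotv v v); apply: crossv_eq0 => //.
    by transitivity (crossv v G - crossv v F); [vec_ring|rewrite -er -er' subrr].
  by exists z; rewrite -e subrKC.
rewrite eG in es.
have [exy z0] : x = y /\ z = 0.
  rewrite /a /b eq es er in rel.
  exact: (bennett_core u1 v1 w1 uv vw n0 rel).
rewrite eq es er z0 scale0r addr0; apply: bennett_of_feet => //.
by rewrite exy.
Qed.

End Triples.

Theorem theorem7 (R : realType) (n : nat) (h : nat -> dquat R)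
  (rot_h : forall i : nat, (1 <= i <= n)%N -> rotation_quat (h i))
  (incompat_h : forall i : nat, (1 <= i)%N -> (i < n)%N -> ~ compatible (h i) (h i.+1)) :
  [/\ forall i : nat, (1 <= i <= n)%N -> ~~ odd (coupling_dim h 1 i),
      (2 <= n)%N ->
        coupling_dim h 1 2 = 4%N /\
        ((forall x : dquat R, x \in coupling_space h 1 2 -> x != 0 -> study x) <->
         concurrent [set axis (h 1%N); axis (h 2%N)]),
      (3 <= n)%N -> coupling_dim h 1 3 = 4%N ->
        concurrent [set axis (h 1%N); axis (h 2%N); axis (h 3%N)]
    & (3 <= n)%N -> coupling_dim h 1 3 = 6%N ->
        bennett_conditions (axis (h 1%N)) (axis (h 2%N)) (axis (h 3%N))].
Proof.
pose a k := unit_line (h k).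
have spaceE i : (i <= n)%N -> coupling_space h 1 i = coupling_space a 1 i.
  move=> lei; apply: coupling_space_affine => k /andP[k1 ki].
  have kn : (1 <= k <= n)%N by rewrite k1 (leq_trans ki lei).
  by have [u [q [_ _ _ _ e]]] := rotation_quat_unit (rot_h k kn).
have dimE i : (i <= n)%N -> coupling_dim h 1 i = coupling_dim a 1 i.
  by move=> lei; rewrite /coupling_dim spaceE.
have data k : (1 <= k <= n)%N -> exists u q,
    [/\ dotv u u = 1, dotv u q = 0, a k = line_quat u q & axis (h k) = plucker_line u q].
  by move=> kn; have [u [q [? ? ? ? _]]] := rotation_quat_unit (rot_h k kn); exists u, q.
split.
- move=> i /andP[i1 lei]; rewrite dimE //; apply: even_coupling_dim => //.
  have [u [q [u1 uq -> _]]] := data i (introT andP (conj i1 lei)).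
  exact: line_quat_sqr.
- move=> n2; rewrite dimE // spaceE // /coupling_dim coupling_space2.
  have [u [q [u1 uq eu au]]] := data 1%N (ltnW n2).
  have [v [r [v1 vr ev av]]] := data 2%N n2.
  have neq : plucker_line u q <> plucker_line v r.
    by rewrite -au -av; apply: incompat_h.
  rewrite eu ev au av; split.
    by apply: dim_binary_span; [exact: line_quat_sqr|exact: line_quat_indep].
  by rewrite study_span // concurrent2 //; apply: unit_neq0.
- move=> n3; have n2 := ltnW n3; rewrite dimE // /coupling_dim coupling_spaceS coupling_space2.
  have [u [q [u1 uq eu au]]] := data 1%N (ltnW n2).
  have [v [r [v1 vr ev av]]] := data 2%N n2.
  have [w [s [w1 ws ew aw]]] := data 3%N n3.
  have neq : plucker_line u q <> plucker_line v r by rewrite -au -av; apply: incompat_h.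
  have neq' : plucker_line v r <> plucker_line w s by rewrite -av -aw; apply: incompat_h.
  rewrite eu ev ew au av aw => dim4; apply: four_dim_concurrent => //.
  apply/addv_idPl/esym/eqP; rewrite eqEdim addvSl dim4 dim_binary_span //.
    exact: line_quat_sqr.
  exact: line_quat_indep.
- move=> n3; have n2 := ltnW n3; rewrite dimE // /coupling_dim coupling_spaceS coupling_space2.
  have [u [q [u1 uq eu au]]] := data 1%N (ltnW n2).
  have [v [r [v1 vr ev av]]] := data 2%N n2.
  have [w [s [w1 ws ew aw]]] := data 3%N n3.
  have neq : plucker_line u q <> plucker_line v r by rewrite -au -av; apply: incompat_h.
  have neq' : plucker_line v r <> plucker_line w s by rewrite -av -aw; apply: incompat_h.
  by rewrite eu ev ew au av aw => dim6; apply: six_dim_bennett.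
Qed.
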